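(* Let $d\ge 0$ be an integer and let $\mathcal{K}$ be the $d$-skeleton of a triangulated $(2d+1)$-sphere. Then $\mathcal{K}$ does not embed (topologically) in the $2d$-sphere $\mathbf{S}^{2d}$.
   Context: A triangulated $(2d+1)$-sphere is a finite simplicial complex whose underlying space is homeomorphic to the $(2d+1)$-sphere (not necessarily piecewise linear). The $d$-skeleton consists of all faces of dimension at most $d$. *)

(* Defs.v *)
From HB Require Import structures.
From mathcomp Require Import all_boot all_order all_algebra.
From mathcomp Require Import all_classical all_reals all_analysis.
Unset Printing Implicit Defensive.
Import Order.TTheory GRing.Theory Num.Theory.
Import numFieldNormedType.Exports.
Local Open Scope ring_scope.

Definition is_simplicial_complex {N : nat} (K : {set {set 'I_N}}) : Prop :=
  finset.set0 \notin K /\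
  (forall s t : {set 'I_N}, s \in K -> t \subset s -> t != finset.set0 -> t \in K).

Definition sc_skeleton {N : nat} (K : {set {set 'I_N}}) (d : nat) : {set {set 'I_N}} :=
  [set s in K | (#|s| <= d.+1)%N].

Local Open Scope classical_set_scope.

(* Geometric realization in R^N: union over faces s of the standard simplex
   spanned by the basis vectors e_i, i in s. *)
Definition geom_realization (R : realType) {N : nat} (K : {set {set 'I_N}})
  : set 'rV[R]_N :=
  [set x | exists2 s, s \in K &
     [/\ (forall i, 0 <= x ord0 i),
         (forall i, i \notin s -> x ord0 i = 0)
       & \sum_i x ord0 i = 1]].


Definition unit_sphere (R : realType) (n : nat) : set 'rV[R]_n.+1 :=
  [set x | \sum_i (x ord0 i) ^+ 2 = 1].


Definition are_homeomorphic {T U : topologicalType} (A : set T) (B : set U) : Prop :=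
  exists (f : T -> U) (g : U -> T),
    [/\ f @` A = B, g @` B = A,
        (forall x, A x -> g (f x) = x) & (forall y, B y -> f (g y) = y)] /\
    {within A, continuous f} /\ {within B, continuous g}.

Definition top_embeds {T U : topologicalType} (A : set T) (B : set U) : Prop :=
  exists f : T -> U, f @` A `<=` B /\
    exists g : U -> T,
      [/\ (forall x, A x -> g (f x) = x),
          {within A, continuous f} & {within f @` A, continuous g}].

(* Main.v *)
(* Write m = 2d + 1, let h be a homeomorphism from the sphere S^m to |K| and let
   f embed the d-skeleton in S^(2d).  The vector h(x) - h(-x) of R^N is odd in x
   and never zero; its positive and negative parts have disjoint supports, both
   faces of K.  Sampling it on a fine Kuhn triangulation, label a vertex v by an
   edge (I v, J v), the positions of its maximum and of its minimum, and
   interpolate the labels: this gives two points p(u), q(u) of the cone over |K|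
   with disjoint supports, exchanged by u -> -u on the boundary of the m-cube
   (viewed as a hemisphere of S^m).  Subtracting the (d+2)-nd largest coordinate
   pushes the cone over |K| to the cone over the d-skeleton, where f extends
   radially to F.  Then u -> F(p(u)) - F(q(u)) is a map to R^m, odd on the
   boundary, so by Borsuk-Ulam it has a zero.

   A zero with both truncations nonzero contradicts the injectivity of f, as the
   supports are disjoint.  If both truncations vanish, then p and q attain their
   maxima at d + 2 positions each.  At most m + 1 = 2d + 2 edges (I v, J v) are in
   play, so at least two components of the graph they form lie inside these
   2d + 4 positions; the p- and q-masses of a component agree, which is impossible
   for two components at once if the coordinates are rescaled by generic weights.

   Borsuk-Ulam is derived from Tucker's lemma, proved by the parity argument of
   Freund and Todd. *)
Require Import Defs.
From mathcomp Require Import all_boot all_order all_algebra perm zify ring lra.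
Set Implicit Arguments.
Unset Strict Implicit.
Unset Printing Implicit Defensive.
Import Order.TTheory GRing.Theory Num.Theory.
Local Open Scope ring_scope.

(** * Tucker's lemma *)

Lemma even_card_involution (T : finType) (P : {set T}) (f : T -> T) :
  {in P, forall x, [/\ f x \in P, f (f x) = x & f x != x]} -> ~~ odd #|P|.
Proof.
elim: {P}_.+1 {-2}P (ltnSn #|P|) => // n IHn P ltPn fP.
have [-> | [x Px]] := set_0Vmem P; first by rewrite cards0.
have [fPx ffx fx_neq] := fP x Px.
have fPx' : f x \in P :\ x by rewrite !inE fx_neq.
move: ltPn; rewrite (cardsD1 x) Px (cardsD1 (f x)) fPx' !add1n /= negbK => ltPn.
apply: IHn => [|y]; first exact: ltnW.
rewrite !inE => /and3P[yfx yx Py]; have [fPy ffy fy_neq] := fP y Py; split=> //.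
apply/and3P; split=> //; first by apply: contraNneq yx => e; rewrite -ffy e ffx.
by apply: contraNneq yfx => e; rewrite -ffy e.
Qed.

Lemma odd_card_fibers (T U : finType) (P : {pred T * U}) (C : {pred T}) :
  (forall x, odd #|[pred y | (x, y) \in P]| = (x \in C)) -> odd #|P| = odd #|C|.
Proof.
move=> oddP; rewrite -!sum1_card.
have -> : (\sum_(z in P) 1 = \sum_x #|[pred y | (x, y) \in P]|)%N.
  rewrite [RHS](eq_bigr (fun x => \sum_(y | (x, y) \in P) 1)%N); last first.
    by move=> x _; rewrite sum1_card.
  by rewrite pair_big_dep /=; apply: eq_bigl => -[].
rewrite [in RHS]big_mkcond /= !(big_morph odd oddD (erefl _)).
by apply: eq_bigr => x _; rewrite oddP; case: (x \in C).
Qed.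

(** * Simplices of the Kuhn triangulation, orthant by orthant, and their labels *)

Section Tucker.
Variables (m M : nat).
Local Notation pt := {ffun 'I_m -> int}.
Definition opp_label (s : 'I_m * bool) := (s.1, ~~ s.2).
Lemma opp_labelK : involutive opp_label.
Proof. by case=> i b; rewrite /opp_label /= negbK. Qed.

Local Notation corner := {ffun 'I_m -> 'I_M.+2}.
Local Notation flag k := {ffun 'I_k -> 'I_m * bool}.

(* A pair (a, f) encodes the k-simplex, in the orthant of signs (f t).2 of the
   coordinate subspace spanned by the (f t).1, whose successive vertices have
   absolute values a, a + e_0, a + e_0 + e_1, ..., where e_t is the basis vector
   of index (f t).1. *)
Definition vertex k (a : corner) (f : flag k) (l : nat) : pt :=
  [ffun i => \sum_(t < k | (f t).1 == i) (-1) ^+ (~~ (f t).2) * (a i + (t < l))%N%:Z].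

(** The bound [< M.+1] keeps the top vertex inside the cube. Coordinates outside the flag do not
    affect [vertex]; pinning them to 0 gives each simplex a single code, as the counting
    requires. *)
Definition kuhn k (x : corner * flag k) : bool :=
  [forall t, forall t', ((x.2 t).1 == (x.2 t').1) ==> (t == t')] &&
  [forall i, if [exists t, (x.2 t).1 == i] then x.1 i < M.+1 else x.1 i == 0%N :> nat]%N.

Lemma kuhnP k (a : corner) (f : flag k) : reflect
  [/\ injective (fun t => (f t).1), forall t, (a (f t).1 < M.+1)%N &
      forall i, (forall t, (f t).1 != i) -> a i = 0%N :> nat] (kuhn (a, f)).
Proof.
apply: (iffP andP) => /= [[/forallP injf /forallP af]|[injf af a0]]; split.
- by move=> t t' /eqP e; have /forallP/(_ t')/implyP/(_ e)/eqP := injf t.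
- by move=> t; have := af (f t).1; case: existsP => // -[]; exists t.
- by move=> i fi; have := af i; case: existsP => [[t]|_ /eqP]; rewrite ?(negPf (fi t)).
- by apply/forallP=> t; apply/forallP=> t'; apply/implyP=> /eqP /injf ->.
- apply/forallP=> i; case: existsP => [[t /eqP <-] //|nf].
  by apply/eqP/a0 => t; apply/eqP=> e; apply: nf; exists t; apply/eqP.
Qed.

Lemma vertexE k (a : corner) (f : flag k) l t : kuhn (a, f) ->
  vertex a f l (f t).1 = (-1) ^+ (~~ (f t).2) * (a (f t).1 + (t < l))%N%:Z.
Proof.
case/kuhnP=> injf _ _; rewrite ffunE (bigD1 t) //= big1 ?addr0 // => t' /andP[/eqP/injf ->].
by rewrite eqxx.
Qed.

Lemma vertex_out k (a : corner) (f : flag k) l i : (forall t, (f t).1 != i) -> vertex a f l i = 0.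
Proof. by move=> fi; rewrite ffunE big1 // => t; rewrite (negPf (fi t)). Qed.

Lemma vertex_in k (a : corner) (f : flag k) l i : kuhn (a, f) -> `|vertex a f l i| <= M.+1%:Z.
Proof.
move=> kf; have [t /eqP <-|nf] := pickP (fun t => (f t).1 == i).
  rewrite vertexE // normrMsign; case/kuhnP: kf => _ /(_ t) af _; case: (t < l)%N; lia.
by rewrite vertex_out // => t; rewrite nf.
Qed.

Lemma vertex_adj k (a : corner) (f : flag k) l l' i : kuhn (a, f) ->
  `|vertex a f l i - vertex a f l' i| <= 1.
Proof.
move=> kf; have [t /eqP <-|nf] := pickP (fun t => (f t).1 == i).
  rewrite !vertexE // -mulrBr normrMsign; case: (t < l)%N; case: (t < l')%N; lia.
by rewrite !vertex_out // => t; rewrite nf.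
Qed.

Variable lab : pt -> 'I_m * bool.
Hypothesis lab_antipodal : forall v : pt, (forall i, `|v i| <= M.+1%:Z) ->
  (exists i, `|v i| = M.+1%:Z) -> lab [ffun i => - v i] = opp_label (lab v).
Hypothesis no_compl : forall v w : pt, (forall i, `|v i| <= M.+1%:Z) ->
  (forall i, `|w i| <= M.+1%:Z) -> (forall i, `|v i - w i| <= 1) -> lab w != opp_label (lab v).

Local Notation vlab x l := (lab (vertex x.1 x.2 l)).

(** The completely labelled simplices of the parity argument: the extra label will supply the
    direction of a simplex one dimension higher. *)
Definition full k (x : corner * flag k) :=
  [forall t, exists l : 'I_k.+1, vlab x l == x.2 t] &&
  [exists l : 'I_k.+1, forall t, vlab x l != x.2 t].

Definition facet_full k (x : corner * flag k) (j : 'I_k.+1) :=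
  [forall t, exists l : 'I_k.+1, (l != j) && (vlab x l == x.2 t)].

Lemma kuhn_inj k (x : corner * flag k) : kuhn x -> injective x.2.
Proof. by case: x => a f /kuhnP[injf _ _] t t' /= e; apply: injf; rewrite e. Qed.

Lemma facet_full_section k (x : corner * flag k) j : facet_full x j ->
  exists e : 'I_k -> 'I_k.+1, forall t, e t != j /\ vlab x (e t) = x.2 t.
Proof.
move=> /forallP Q; exists (fun t => xchoose (existsP (Q t))) => t.
by have /andP[-> /eqP ->] := xchooseP (existsP (Q t)).
Qed.

Lemma ord_inj_missed k (e : 'I_k -> 'I_k.+1) j : injective e -> (forall t, e t != j) ->
  forall l, l != j -> exists t, l = e t.
Proof.
move=> inje ej l lj; have : [set l' | l' != j] \subset [set e t | t : 'I_k].
  have sub : [set e t | t : 'I_k] \subset [set l' | l' != j].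
    by apply/subsetP=> _ /imsetP[t _ ->]; rewrite inE.
  suff /eqP -> : [set e t | t : 'I_k] == [set l' | l' != j] by [].
  rewrite eqEcard sub card_imset // card_ord.
  have -> : [set l' | l' != j] = [set~ j] by apply/setP=> l'; rewrite !inE.
  by rewrite cardsC1 card_ord leqnn.
by move/subsetP/(_ l); rewrite inE lj => /(_ isT)/imsetP[t _ ->]; exists t.
Qed.

Lemma facet_full_image k (x : corner * flag k) j l : kuhn x -> facet_full x j -> l != j ->
  exists t, vlab x l = x.2 t.
Proof.
move=> kx /facet_full_section[e eP] lj.
have inje : injective e.
  by move=> t t' ett; apply: (kuhn_inj kx); rewrite -(eP t).2 -(eP t').2 ett.
have [t ->] := ord_inj_missed inje (fun t => (eP t).1) lj.
by exists t; case: (eP t).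
Qed.

(** If all [k] labels occur, a choice [e] of a vertex for each misses one vertex [j0]. A label
    outside the flag at [j0] leaves one full facet, opposite [j0]; a repeated label, shared with
    [e t0], leaves two, opposite [j0] and [e t0]. *)
Lemma odd_facets k (x : corner * flag k) : kuhn x ->
  odd #|[pred j | facet_full x j]| = full x.
Proof.
move=> kx; have injx := kuhn_inj kx.
have [/forallP allx|nall] := boolP [forall t, exists l : 'I_k.+1, vlab x l == x.2 t]; last first.
  rewrite /full (negPf nall) eq_card0 // => j; rewrite inE; apply: contraNF nall => /forallP Q.
  by apply/forallP => t; have /existsP[l /andP[_ ?]] := Q t; apply/existsP; exists l.
pose e t := xchoose (existsP (allx t)).
have eP t : vlab x (e t) = x.2 t by apply/eqP/(xchooseP (existsP (allx t))).
have inje : injective e by move=> t t' ett; apply: injx; rewrite -!eP ett.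
have [j0 j0P] : exists j0, forall t, e t != j0.
  have [j0 /forallP j0P|nj] := pickP (fun j => [forall t, e t != j]); first by exists j0.
  suff : (#|'I_k.+1| <= #|'I_k|)%N by rewrite !card_ord ltnn.
  rewrite -(card_imset _ inje) subset_leq_card //; apply/subsetP => j _.
  have /negbT := nj j; rewrite negb_forall => /existsP[t]; rewrite negbK => /eqP <-.
  exact: imset_f.
have [t0 /eqP t0P|nt0] := pickP (fun t => vlab x j0 == x.2 t).
  have -> : full x = false.
    apply/negP => /andP[_ /existsP[l /forallP lP]].
    have [lj0|lj0] := eqVneq l j0; first by have := lP t0; rewrite lj0 t0P eqxx.
    have [t lt] := ord_inj_missed inje j0P lj0.
    by have := lP t; rewrite lt eP eqxx.
  rewrite (@eq_card _ _ (pred2 j0 (e t0))) ?card2 1?eq_sym ?j0P // => j; rewrite !inE.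
  apply/idP/orP => [/forallP Q|].
    have [->|jj0] := eqVneq j j0; [by left|right].
    have [t jt] := ord_inj_missed inje j0P jj0.
    have /existsP[l /andP[lj /eqP lt]] := Q t.
    have [lj0|lj0] := eqVneq l j0.
      by apply/eqP; rewrite jt; congr (e _); apply: injx; rewrite -lt -t0P lj0.
    have [t' lt'] := ord_inj_missed inje j0P lj0.
    move: lt; rewrite lt' eP => /injx tt; by rewrite lt' tt -jt eqxx in lj.
  move=> jP; apply/forallP => t; apply/existsP.
  case: jP => /eqP ->.
    by exists (e t); rewrite j0P eP eqxx.
  have [->|tt0] := eqVneq t t0; first by exists j0; rewrite eq_sym j0P t0P eqxx.
  by exists (e t); rewrite eP eqxx andbT; apply: contraNneq tt0 => /inje ->.
rewrite (@eq_card _ _ (pred1 j0)) ?card1.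
  symmetry; apply/andP; split; first exact/forallP.
  by apply/existsP; exists j0; apply/forallP => t; rewrite nt0.
move=> j; rewrite !inE; apply/forallP/eqP => [Q|-> t].
  apply/eqP/negPn/negP => jj0; have [t jt] := ord_inj_missed inje j0P jj0.
  have /existsP[l /andP[lj /eqP lt]] := Q t.
  have [lj0|lj0] := eqVneq l j0; first by have := nt0 t; rewrite -lj0 lt eqxx.
  have [t' lt'] := ord_inj_missed inje j0P lj0.
  by move: lt; rewrite lt' eP => /injx tt; rewrite lt' tt -jt eqxx in lj.
by apply/existsP; exists (e t); rewrite j0P eP eqxx.
Qed.

Definition full_set k := [pred x : corner * flag k | kuhn x && full x].
Definition facet_set k := [pred z : (corner * flag k) * 'I_k.+1 | kuhn z.1 && facet_full z.1 z.2].

Lemma odd_facet_set k : odd #|facet_set k| = odd #|full_set k|.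
Proof.
apply: odd_card_fibers => x; rewrite inE; have [kx|kx] := boolP (kuhn x); last first.
  by rewrite eq_card0 // => j; rewrite !inE (negPf kx).
by rewrite -(odd_facets kx); congr odd; apply: eq_card => j; rewrite !inE kx.
Qed.

Lemma vertex_reindex k (a a' : corner) (f : flag k) (g : 'I_k -> 'I_k) l l' :
  bijective g ->
  (forall t, a (f (g t)).1 + (g t < l) = a' (f (g t)).1 + (t < l') :> nat)%N ->
  vertex a' [ffun t => f (g t)] l' = vertex a f l.
Proof.
move=> bg e; apply/ffunP => i; rewrite !ffunE [RHS](reindex g); last exact: onW_bij.
apply: eq_big => [t|t]; rewrite ffunE // => /eqP <-; by rewrite e.
Qed.

Lemma facet_full_move k (a a' : corner) (f : flag k) (g : 'I_k -> 'I_k) (j j' : 'I_k.+1) :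
  (forall l : 'I_k.+1, l != j -> exists2 l' : 'I_k.+1, l' != j' &
     vertex a' [ffun t => f (g t)] l' = vertex a f l) ->
  facet_full (a, f) j -> facet_full (a', [ffun t => f (g t)]) j'.
Proof.
move=> H /forallP Q; apply/forallP => t; have /existsP[l /andP[lj /eqP lt]] := Q (g t).
have [l' lj' e] := H l lj; apply/existsP; exists l'.
by rewrite lj' /= e lt ffunE.
Qed.

Lemma kuhn_move k (a a' : corner) (f : flag k) (g : 'I_k -> 'I_k) : bijective g ->
  (forall t, (a' (f t).1 < M.+1)%N) -> (forall i, (forall t, (f t).1 != i) -> a' i = a i) ->
  kuhn (a, f) -> kuhn (a', [ffun t => f (g t)]).
Proof.
move=> [g' gK g'K] lt_a' eq_a' /kuhnP[injf af a0]; apply/kuhnP; split=> [t t'|t|i fi].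
- by rewrite !ffunE => /injf /(can_inj gK).
- by rewrite ffunE.
- have fi' t : (f t).1 != i by have := fi (g' t); rewrite ffunE g'K.
  by rewrite eq_a' // a0.
Qed.

(** * Pairing of facets, from dimension [k + 1] down to [k] *)

Section Step.
Variable k : nat.

(** [inord] would turn an overflow into 0; off the outer facets the entry increased by [flip] is at
    most [M], so none occurs. *)
Definition shift_at (h : nat -> nat) (i0 : 'I_m) (a : corner) : corner :=
  [ffun i => if i == i0 then inord (h (a i)) else a i].

(** All vertices of such a facet have absolute value [M + 1] in the first direction, so it lies on
    the boundary of the cube; those of an [inner_facet] vanish in the last direction, so it lies on
    a wall of the orthant. *)
Definition outer_facet (z : (corner * flag k.+1) * 'I_k.+2) :=
  (z.2 == ord0) && (z.1.1 (z.1.2 ord0).1 == M :> nat).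
Definition inner_facet (z : (corner * flag k.+1) * 'I_k.+2) :=
  (z.2 == ord_max) && (z.1.1 (z.1.2 ord_max).1 == 0 :> nat)%N.

(** Exchanging the steps [j - 1] and [j] of the path changes only its vertex [j]. The [inord] is
    faithful for [0 < j < k + 1], the only case used. *)
Definition swap_at (j : 'I_k.+2) : {perm 'I_k.+1} := tperm (inord j.-1) (inord j).

(* The other simplex of the same orthant that shares the facet opposite to the
   vertex z.2, for facets that are not on the boundary of the orthant. *)
Definition flip (z : (corner * flag k.+1) * 'I_k.+2) : (corner * flag k.+1) * 'I_k.+2 :=
  let: ((a, f), j) := z in
  if j == ord0 then ((shift_at succn (f ord0).1 a, [ffun t => f (ordS t)]), ord_max)
  else if j == ord_max then ((shift_at predn (f ord_max).1 a, [ffun t => f (ord_pred t)]), ord0)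
  else ((a, [ffun t => f (swap_at j t)]), j).

Lemma ordS_max : ordS (@ord_max k) = ord0.
Proof. by apply: val_inj; rewrite /= modnn. Qed.

Lemma ord_pred0 : ord_pred (@ord0 k) = ord_max.
Proof. by rewrite -ordS_max ordSK. Qed.

Lemma val_ordS (t : 'I_k.+1) : t != ord_max -> ordS t = t.+1 :> nat.
Proof.
move=> tm; rewrite /= modn_small // ltnS ltn_neqAle -ltnS ltn_ord andbT.
by apply: contraNneq tm => e; apply/eqP/val_inj.
Qed.

Lemma val_ord_pred (t : 'I_k.+1) : t != ord0 -> ord_pred t = t.-1 :> nat.
Proof.
move=> t0; have t_gt0 : (0 < t)%N by rewrite lt0n; apply: contraNneq t0 => e; apply/eqP/val_inj.
by rewrite /= -(prednK t_gt0) addSn /= modnDr modn_small //; have := ltn_ord t; lia.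
Qed.

(** Moving the first step of the path to its end and the last to its front are inverse operations;
    exchanging two consecutive steps is its own inverse. The excluded facets are those where the
    shifted corner would leave the cube or cross a wall. *)
Lemma flip_facet z : z \in facet_set k.+1 -> ~~ outer_facet z -> ~~ inner_facet z ->
  [/\ flip z \in facet_set k.+1, ~~ outer_facet (flip z), ~~ inner_facet (flip z),
      flip (flip z) = z & flip z != z].
Proof.
case: z => [[a f] j]; rewrite inE /= => /andP[kf Q].
have [injf af a0] := kuhnP _ _ kf.
rewrite /outer_facet /inner_facet /flip.
case: (eqVneq j ord0) Q => [->{j}|j0] Q /=.
  have fS : [ffun t => f (ordS t)] ord_max = f ord0 by rewrite ffunE ordS_max.
  move=> aM _; have lta : (a (f ord0).1 < M)%N by have := af ord0; lia.
  have sE : shift_at succn (f ord0).1 a (f ord0).1 = (a (f ord0).1).+1 :> nat.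
    by rewrite ffunE eqxx inordK //; lia.
  have sN i : i != (f ord0).1 -> shift_at succn (f ord0).1 a i = a i.
    by rewrite ffunE => /negPf ->.
  split.
  - rewrite inE /=; apply/andP; split.
      apply: kuhn_move kf; first exact: ordS_bij.
        move=> t; have [->|tn] := eqVneq t ord0; first by rewrite sE.
        by rewrite sN ?af //; apply: contraNneq tn => /injf ->.
      by move=> i fi; rewrite sN // eq_sym fi.
    apply: facet_full_move Q => l l0; have lt_l : (l.-1 < k.+2)%N by have := ltn_ord l; lia.
    have l_gt0 : (0 < l)%N by rewrite lt0n; apply: contraNneq l0 => e; apply/eqP/val_inj.
    exists (Ordinal lt_l); first by rewrite -val_eqE /=; have := ltn_ord l; lia.
    apply: vertex_reindex; first exact: ordS_bij.
    move=> t; have [->|tm] := eqVneq t ord_max.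
      by rewrite ordS_max sE /=; have := ltn_ord l; lia.
    rewrite sN ?val_ordS //=; first by lia.
    by apply/eqP => /injf e; have := val_ordS tm; rewrite e.
  - by [].
  - by rewrite eqxx /= fS sE.
  - rewrite eqxx fS; congr (_, _, _).
      apply/ffunP => i; rewrite ffunE; case: eqP => [->|/eqP/sN //].
      by apply: val_inj; rewrite /= inordK sE; lia.
    by apply/ffunP => t; rewrite !ffunE ord_predK.
  - by apply/eqP => -[].
case: (eqVneq j ord_max) j0 Q => [->{j}|jm] j0 Q /=.
  have fP : [ffun t => f (ord_pred t)] ord0 = f ord_max by rewrite ffunE ord_pred0.
  move=> _ aM; have lta : (0 < a (f ord_max).1)%N by lia.
  have ltM := af ord_max.
  have sE : shift_at predn (f ord_max).1 a (f ord_max).1 = (a (f ord_max).1).-1 :> nat.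
    by rewrite ffunE eqxx inordK //; lia.
  have sN i : i != (f ord_max).1 -> shift_at predn (f ord_max).1 a i = a i.
    by rewrite ffunE => /negPf ->.
  split.
  - rewrite inE /=; apply/andP; split.
      apply: kuhn_move kf; first exact: ord_pred_bij.
        move=> t; have [->|tn] := eqVneq t ord_max; first by rewrite sE; lia.
        by rewrite sN ?af //; apply: contraNneq tn => /injf ->.
      by move=> i fi; rewrite sN // eq_sym fi.
    apply: facet_full_move Q => l l0.
    have l_lt : (l < k.+1)%N.
      by have := ltn_ord l; move: l0; rewrite -val_eqE /=; lia.
    exists (Ordinal (l_lt : (l.+1 < k.+2)%N)) => //.
    apply: vertex_reindex; first exact: ord_pred_bij.
    move=> t; have [->|tm] := eqVneq t ord0.
      by rewrite ord_pred0 sE /=; lia.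
    have t_gt0 : (0 < t)%N by rewrite lt0n; apply: contraNneq tm => e; apply/eqP/val_inj.
    rewrite sN ?val_ord_pred //=; first by lia.
    apply/eqP => /injf e; have := val_ord_pred tm; rewrite e /=; have := ltn_ord t; lia.
  - by rewrite fP sE; lia.
  - by [].
  - rewrite fP; congr (_, _, _).
      apply/ffunP => i; rewrite ffunE; case: eqP => [->|/eqP/sN //].
      by apply: val_inj; rewrite /= inordK sE; lia.
    by apply/ffunP => t; rewrite !ffunE ordSK.
  - by apply/eqP => -[].
move=> _ _; rewrite (negPf j0) (negPf jm) /=.
have j_gt0 : (0 < j)%N by rewrite lt0n; apply: contraNneq j0 => e; apply/eqP/val_inj.
have j_lt : (j < k.+1)%N by have := ltn_ord j; move: jm; rewrite -val_eqE /=; lia.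
split=> //.
- rewrite inE /=; apply/andP; split.
    by apply: kuhn_move kf => //; exists (swap_at j) => t; exact: tpermK.
  apply: facet_full_move Q => l lj; exists l => //.
  apply: vertex_reindex; first by exists (swap_at j) => t; exact: tpermK.
  move=> t; congr (_ + nat_of_bool _)%N.
  have lj' : l != j :> nat by [].
  by rewrite /swap_at; case: tpermP => [->|->|//]; rewrite !inordK; lia.
- by congr (_, _, _); apply/ffunP => t; rewrite !ffunE /swap_at tpermK.
- apply/eqP => -[] /ffunP/(_ (inord j)).
  rewrite ffunE /swap_at tpermR => /(congr1 fst)/injf/(congr1 val).
  by rewrite /= !inordK; lia.
Qed.


(** The antipodal map keeps the corner and reverses all signs of the flag. Labels reverse on the
    boundary of the cube, so full facets go to full facets, and no nonempty flag equals its
    reversal. *)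
Lemma even_outer : ~~ odd #|[pred z | (z \in facet_set k.+1) && outer_facet z]|.
Proof.
pose opp (z : (corner * flag k.+1) * 'I_k.+2) : (corner * flag k.+1) * 'I_k.+2 :=
  ((z.1.1, [ffun t => opp_label (z.1.2 t)]), z.2).
rewrite -cardsE; apply: (@even_card_involution _ _ opp).
move=> [[a f] j]; rewrite !inE /outer_facet /=.
move=> /andP[/andP[kf /forallP Q] /andP[/eqP j0 aM]].
have [injf af a0] := kuhnP _ _ kf.
have kf' : kuhn (a, [ffun t => opp_label (f t)]).
  apply/kuhnP; split=> [t t'|t|i fi]; rewrite ?ffunE; [exact: injf|exact: af|].
  by apply: a0 => t; have := fi t; rewrite ffunE.
split.
- rewrite kf' j0 eqxx ffunE aM !andbT /=; apply/forallP => t.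
  have /existsP[l /andP[lj /eqP lt]] := Q t; apply/existsP; exists l; rewrite -j0 lj /=.
  have l_gt0 : (0 < l)%N by rewrite lt0n; apply: contraNneq lj => e; rewrite j0; apply/eqP/val_inj.
  have -> : vertex a [ffun t => opp_label (f t)] l = [ffun i => - vertex a f l i].
    apply/ffunP => i; rewrite !ffunE -sumrN; apply: eq_big => [t'|t' _]; rewrite !ffunE //=.
    by case: (f t').2; rewrite /= ?expr0 ?expr1 ?mulN1r ?mul1r ?opprK.
  rewrite lab_antipodal ?lt ?ffunE //; first by move=> i; exact: vertex_in.
  (* The facet omits vertex 0, so [l > 0] and the first direction has absolute value [M + 1]. *)
  exists (f ord0).1; rewrite vertexE // normrMsign l_gt0 (eqP aM); lia.
- by congr (_, _, _); apply/ffunP => t; rewrite !ffunE opp_labelK.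
- apply/eqP => -[] /ffunP/(_ ord0); rewrite ffunE => /(congr1 snd) /=; by case: (f ord0).2.
Qed.

Lemma vertex_widen (a : corner) (f : flag k.+1) l : a (f ord_max).1 = 0%N :> nat -> (l <= k)%N ->
  vertex a [ffun t => f (widen_ord (leqnSn k) t)] l = vertex a f l.
Proof.
move=> a0 lk; apply/ffunP => i; rewrite !ffunE [RHS]big_mkcond big_ord_recr /= -big_mkcond /=.
rewrite [X in _ + X](_ : _ = 0) ?addr0; first by apply: eq_big => [t|t _]; rewrite ffunE.
by case: eqP => // <-; rewrite a0 ltnNge lk mulr0.
Qed.

(** Without its last direction, an inner full facet is a simplex of dimension [k] labelled by its
    own signed coordinates and the removed one, hence full. Conversely the extra label of a full
    simplex names a new coordinate and can be appended as last direction. *)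
Lemma card_inner :
  #|[pred z | (z \in facet_set k.+1) && inner_facet z]| = #|full_set k|.
Proof.
pose D := [set z | (z \in facet_set k.+1) && inner_facet z].
pose drop (z : (corner * flag k.+1) * 'I_k.+2) : corner * flag k :=
  (z.1.1, [ffun t => z.1.2 (widen_ord (leqnSn k) t)]).
have wl (l : 'I_k.+2) : l != ord_max -> (l < k.+1)%N.
  by have := ltn_ord l; rewrite -val_eqE /=; lia.
have DP a f j : ((a, f), j) \in D ->
    [/\ kuhn (a, f), facet_full (a, f) j, j = ord_max & a (f ord_max).1 = 0%N :> nat].
  by rewrite !inE /inner_facet /= => /andP[/andP[-> ->] /andP[/eqP -> /eqP ->]].
rewrite -[LHS](_ : #|D| = _); last by apply: eq_card => z; rewrite !inE.
rewrite -(@card_in_imset _ _ drop D).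
  rewrite -[RHS](_ : #|[set x in full_set k]| = _); last by apply: eq_card => z; rewrite !inE.
  congr #|pred_of_set _|; apply/setP => -[a f]; rewrite [RHS]inE.
  apply/imsetP/idP => [[[[a' f'] j] /DP[kf Q jm am] [-> ->]]|].
    have [injf af a0] := kuhnP _ _ kf; rewrite inE; apply/andP; split.
      apply/kuhnP; split=> [t t'|t|i fi]; rewrite ?ffunE //.
        by move=> /injf/(congr1 val)/= e; exact: val_inj.
      have [->//|im] := eqVneq i (f' ord_max).1.
      apply: a0 => t; have [->|tm] := eqVneq t ord_max; first by rewrite eq_sym.
      have tk : (t < k)%N by have := ltn_ord t; move: tm; rewrite -val_eqE /=; lia.
      have := fi (Ordinal tk); rewrite ffunE.
      by rewrite [widen_ord _ _](_ : _ = t) //; exact: val_inj.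
    have lk (l : 'I_k.+2) : l != j -> (l < k.+1)%N by rewrite jm; exact: wl.
    apply/andP; split.
      apply/forallP => t; move/forallP/(_ (widen_ord (leqnSn k) t))/existsP: Q => [l /andP[lj lt]].
      apply/existsP; exists (Ordinal (lk l lj)).
      by rewrite /= vertex_widen ?ffunE //; exact: (lk l lj).
    move/forallP/(_ ord_max)/existsP: Q => [l /andP[lj /eqP lt]].
    apply/existsP; exists (Ordinal (lk l lj)); apply/forallP => t.
    rewrite /= vertex_widen ?ffunE //; last exact: (lk l lj).
    rewrite lt; apply/eqP => /(congr1 fst)/injf/(congr1 val) /=.
    by have := ltn_ord t; lia.
  rewrite inE => /andP[kf /andP[/forallP Q /existsP[l0 /forallP l0P]]].
  have [injf af a0] := kuhnP _ _ kf.
  pose s := lab (vertex a f l0).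
  (* The extra label is not in the flag; were its coordinate there, it would be opposite to a label
     of the same simplex, which [no_compl] forbids. *)
  have fs t : (f t).1 != s.1.
    apply/eqP => e; have /existsP[l /eqP lt] := Q t.
    have := no_compl (fun i => vertex_in l i kf) (fun i => vertex_in l0 i kf)
      (fun i => vertex_adj l l0 i kf).
    have := l0P t; rewrite /= -/s lt.
    by case: s e => [i b]; case: (f t) => i' b' /= ->; case: b; case: b'; rewrite eqxx.
  pose f' : flag k.+1 := [ffun t => if unlift ord_max t is Some t' then f t' else s].
  have f'w (t : 'I_k) : f' (widen_ord (leqnSn k) t) = f t.
    rewrite ffunE [widen_ord _ _](_ : _ = lift ord_max t) ?liftK //.
    by apply: val_inj; rewrite /= /bump leqNgt ltn_ord.
  have f'm : f' ord_max = s by rewrite ffunE unlift_none.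
  have fE : f = [ffun t => f' (widen_ord (leqnSn k) t)] by apply/ffunP => t; rewrite ffunE f'w.
  have as0 : a s.1 = 0%N :> nat by apply: a0.
  have f'P (t : 'I_k.+1) : t = ord_max \/ exists t', t = widen_ord (leqnSn k) t'.
    have [->|tm] := eqVneq t ord_max; [by left|right].
    have tk : (t < k)%N by have := ltn_ord t; move: tm; rewrite -val_eqE /=; lia.
    by exists (Ordinal tk); exact: val_inj.
  exists ((a, f'), ord_max); last by rewrite /drop /= -fE.
  have vE (l : 'I_k.+1) : vertex a f' l = vertex a f l.
    by rewrite fE vertex_widen ?f'm // -ltnS.
  rewrite !inE /inner_facet /= eqxx f'm as0 eqxx !andbT; apply/andP; split.
    apply/kuhnP; split=> [t t'|t|i fi].
    - case: (f'P t) (f'P t') => [->|[u ->]] [->|[u' ->]]; rewrite ?f'w ?f'm //.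
      + by move/esym/eqP; rewrite (negPf (fs _)).
      + by move/eqP; rewrite (negPf (fs _)).
      + by move/injf ->.
    - by case: (f'P t) => [->|[u ->]]; rewrite ?f'w ?f'm ?as0.
    - by apply: a0 => t; rewrite -f'w.
  apply/forallP => t; case: (f'P t) => [->|[u ->]]; apply/existsP.
    exists (widen_ord (leqnSn _) l0); rewrite f'm /= vE eqxx andbT.
    by rewrite -val_eqE /=; have := ltn_ord l0; lia.
  have /existsP[l lt] := Q u; exists (widen_ord (leqnSn _) l); rewrite f'w /= vE lt andbT.
  by rewrite -val_eqE /=; have := ltn_ord l; lia.
move=> [[a f] j] [[a' f'] j'] /DP[kf Q jm am] /DP[kf' Q' jm' am'] [aa /ffunP ff].
move: jm jm' Q Q' => -> -> Q Q'.
move: aa kf' Q' am' => <- kf' Q' am'.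
congr (_, _, _); apply/ffunP => t.
have ffw (t' : 'I_k) : f (widen_ord (leqnSn k) t') = f' (widen_ord (leqnSn k) t').
  by have := ff t'; rewrite !ffunE.
have f'P (u : 'I_k.+1) : u = ord_max \/ exists t', u = widen_ord (leqnSn k) t'.
  have [->|um] := eqVneq u ord_max; [by left|right].
  have uk : (u < k)%N by have := ltn_ord u; move: um; rewrite -val_eqE /=; lia.
  by exists (Ordinal uk); exact: val_inj.
case: (f'P t) => [->|[u ->]] //.
(* The removed direction is determined by the labels: the vertex labelled [f ord_max] belongs to
   both facets, and in [f'] its label can only be the last one, the others being shared with [f]. *)
have /forallP/(_ ord_max)/existsP[l /andP[lm /eqP /= lt]] := Q.
have [u /= lu] := facet_full_image kf' Q' lm.
have vv : vertex a f l = vertex a f' l.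
  rewrite -vertex_widen //; last by have := wl _ lm.
  rewrite -[RHS]vertex_widen //; last by have := wl _ lm.
  by congr (vertex _ _ _); apply/ffunP => u'; rewrite !ffunE.
case: (f'P u) lu => [->|[u' ->]] lu; first by rewrite -lt vv lu.
have := lt; rewrite vv lu -ffw => /(kuhn_inj kf)/(congr1 val) /=.
by have := ltn_ord u'; lia.
Qed.

(* The facets carrying exactly the signed coordinates of their simplex as labels,
   counted simplex by simplex, give full_set k.+1 modulo 2.  Counted facet by
   facet, those shared by two simplices cancel, those on the boundary of the cube
   cancel with their antipodes, and the others, on a wall of the orthant, are the
   elements of full_set k. *)
Lemma odd_full_step : odd #|full_set k.+1| = odd #|full_set k|.
Proof.
have inner_outer z : inner_facet z -> ~~ outer_facet z.
  by rewrite /inner_facet /outer_facet => /andP[/eqP -> _].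
rewrite -odd_facet_set -card_inner.
have -> : #|facet_set k.+1| = (#|[pred z | (z \in facet_set k.+1) && outer_facet z]| +
    (#|[pred z | (z \in facet_set k.+1) && inner_facet z]| +
     #|[set z | [&& z \in facet_set k.+1, ~~ outer_facet z & ~~ inner_facet z]]|))%N.
  rewrite -!sum1_card (bigID outer_facet) /=; congr (_ + _)%N.
  rewrite (bigID inner_facet) /=; congr (_ + _)%N; apply: eq_bigl => z; last by rewrite !inE !andbA.
  rewrite [RHS]inE /= -andbA; case inz: (inner_facet z); rewrite ?andbF //.
  by rewrite (inner_outer z) ?andbT.
rewrite !oddD (negbTE even_outer) [X in _ (+) X]addbC.
set S := finset _; rewrite (negbTE (@even_card_involution _ S flip _)) //.
move=> z; rewrite 2!inE => /and3P[zF zo zi].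
have [? ? ? ? ?] := flip_facet zF zo zi.
by split=> //; rewrite inE; apply/and3P.
Qed.

End Step.

(** The induction starts at the origin, the only simplex of dimension 0, whose label lies outside
    the empty flag. *)
Lemma odd_full_set k : odd #|full_set k|.
Proof.
elim: k => [|k IHk]; last by rewrite odd_full_step.
pose x0 : corner * flag 0 := ([ffun => ord0], [ffun t => lab [ffun => 0]]).
rewrite (@eq_card1 _ x0) // => -[a f]; rewrite !inE /=.
apply/andP/eqP => [[/kuhnP[_ _ a0] _]|[-> ->]].
  congr (_, _); apply/ffunP; last by case.
  by move=> i; rewrite ffunE; apply: val_inj; apply: a0 => -[].
split; first by apply/kuhnP; split=> [[]|[]|i _]//; rewrite ffunE.
apply/andP; split; first by apply/forallP => -[].
by apply/existsP; exists ord0; apply/forallP => -[].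
Qed.

(** In dimension [m] the flag uses every coordinate, so the extra label of a full simplex is
    opposite to the label of another vertex. *)
Lemma no_compl_absurd : False.
Proof.
have := odd_full_set m; rewrite eq_card0 // => -[a f]; rewrite !inE.
apply/negP => /andP[kf /andP[/forallP Q /existsP[l0 /forallP l0P]]].
have [injf _ _] := kuhnP _ _ kf.
have [g _ gK] := injF_bij injf.
pose t := g (lab (vertex a f l0)).1; have := gK (lab (vertex a f l0)).1; rewrite -/t => e.
have /existsP[l /eqP lt] := Q t.
have := no_compl (fun i => vertex_in l i kf) (fun i => vertex_in l0 i kf)
  (fun i => vertex_adj l l0 i kf).
have := l0P t; rewrite /= lt.
by case: (lab _) e => [i b]; case: (f t) => i' b' /= ->; case: b; case: b'; rewrite eqxx.
Qed.

End Tucker.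

(** * Ties between weighted bipartite graphs *)

(** Adding an edge merges at most two classes, so the number of classes drops by at most one. *)
Lemma graph_classes (T : finType) (E : seq (T * T)) : exists comp : T -> T,
  {in E, forall e, comp e.1 = comp e.2} /\ (#|T| <= #|[set comp x | x : T]| + size E)%N.
Proof.
elim: E => [|[x y] E [comp [compE cardT]]].
  by exists id; split=> //; rewrite addn0 card_imset.
pose comp' z := if comp z == comp y then comp x else comp z.
exists comp'; split=> [e|].
  rewrite inE /comp' => /orP[/eqP ->|eE] /=; first by rewrite eqxx; case: ifP.
  by rewrite compE.
apply: leq_trans cardT _; rewrite /= addnS -addSn leq_add2r -add1n.
apply: leq_trans (_ : #|comp y |: [set comp' z | z : T]| <= _)%N; last first.
  by rewrite cardsU1 leq_add2r; case: (_ \notin _).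
apply/subset_leq_card/subsetP => _ /imsetP[z _ ->]; rewrite !inE.
case: eqVneq => //= zy; apply/imsetP; exists z => //.
by rewrite /comp' (negPf zy).
Qed.

(** There are at least [#|T| - size E] classes, and at most [#|~: S|] of them meet the complement of
    [S], so two remain inside [S]. *)
Lemma two_inner_classes (T : finType) (E : seq (T * T)) (S : {set T}) : (size E + 2 <= #|S|)%N ->
  exists comp : T -> T, {in E, forall e, comp e.1 = comp e.2} /\
    exists x y, comp x != comp y /\
      forall z, comp z = comp x \/ comp z = comp y -> z \in S.
Proof.
move=> ES; have [comp [compE cardT]] := graph_classes E.
exists comp; split=> //.
pose C := [set comp x | x : T] :\: [set comp x | x in ~: S].
have /card_gt1P[r1 [r2 [r1C r2C r12]]] : (1 < #|C|)%N.
  have imS : (#|[set comp x | x in ~: S]| <= #|~: S|)%N by exact: leq_imset_card.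
  have capS := subset_leq_card (subsetIr [set comp x | x : T] [set comp x | x in ~: S]).
  by rewrite cardsD; have := cardsC S; move: imS capS cardT ES; lia.
have inS r z : r \in C -> comp z = r -> z \in S.
  rewrite inE => /andP[rS _] zr; apply: contraNT rS => zS; apply/imsetP; exists z => //.
  by rewrite inE.
have [x _ xr1] : exists2 x, x \in T & r1 = comp x by move: r1C; rewrite inE => /andP[_ /imsetP].
have [y _ yr2] : exists2 y, y \in T & r2 = comp y by move: r2C; rewrite inE => /andP[_ /imsetP].
exists x, y; rewrite -xr1 -yr2; split=> // z [] /inS; exact.
Qed.

(* Each weight exceeds the square of the sum of the previous ones, so the largest
   index decides the comparison of two products of totals. *)
Fixpoint weight_sum n := (if n is n'.+1 then weight_sum n' + ((weight_sum n') ^ 2).+1 else 0)%N.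
Definition weight n := ((weight_sum n) ^ 2).+1.

Lemma sum_weight n : (\sum_(i < n) weight i = weight_sum n)%N.
Proof. by elim: n => [|n IHn]; rewrite ?big_ord0 // big_ord_recr /= IHn. Qed.

Section Weight.
Variable N : nat.
Implicit Types X Y : {set 'I_N}.

Local Notation total X := (\sum_(i in X) weight i)%N.

Lemma total_lt X (i : 'I_N) : (forall k, k \in X -> (k < i)%N) -> (total X <= weight_sum i)%N.
Proof.
move=> Xi; rewrite -sum_weight (big_ord_widen N weight (ltnW (ltn_ord i))).
rewrite [leqRHS](bigID (mem X)) /= (eq_bigl (fun k : 'I_N => (k < i)%N && (k \in X))) ?leq_addr //.
by move=> k; case kX: (k \in X); rewrite ?andbF // Xi.
Qed.

Lemma total_ge X (i : 'I_N) : i \in X -> (weight i <= total X)%N.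
Proof. by move=> iX; rewrite (bigD1 i) //= leq_addr. Qed.

Lemma total_lt_prod X X' Y Y' (i j : 'I_N) : i \in X -> j \in X' ->
  (forall k, k \in Y -> (k < i)%N) -> (forall k, k \in Y' -> (k < i)%N) ->
  (total Y * total Y' < total X * total X')%N.
Proof.
move=> iX jX' Yi Y'i; apply: leq_ltn_trans (leq_mul (total_lt Yi) (total_lt Y'i)) _.
apply: leq_trans (_ : weight i * weight j <= _)%N; last by rewrite leq_mul ?total_ge.
by rewrite mulnn (leq_trans (_ : _ < weight i)%N) // leq_pmulr.
Qed.

(** The largest index of all four sets belongs to one side of the comparison; by disjointness it
    exceeds every index on the other side, so its weight decides. *)
Lemma total_prod_neq (A1 B1 A2 B2 : {set 'I_N}) :
  A1 != set0 -> B1 != set0 -> A2 != set0 -> B2 != set0 ->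
  [disjoint A1 & A2] -> [disjoint A1 & B1] -> [disjoint B2 & A2] -> [disjoint B2 & B1] ->
  (total A1 * total B2 != total A2 * total B1)%N.
Proof.
move=> /set0Pn[a1 a1P] /set0Pn[b1 b1P] /set0Pn[a2 a2P] /set0Pn[b2 b2P] dAA dAB dBA dBB.
have sepP (X Y : {set 'I_N}) (i : 'I_N) : [disjoint X & Y] -> i \in X ->
    (forall k, k \in Y -> (k <= i)%N) -> forall k, k \in Y -> (k < i)%N.
  move=> dXY iX Yi k kY; rewrite ltn_neqAle Yi // andbT; apply: contraTneq kY => /val_inj ->.
  by rewrite (disjointFr dXY).
pose U := (A1 :|: B2) :|: (A2 :|: B1).
have a1U : a1 \in U by rewrite !inE a1P.
case: (arg_maxnP (fun k : 'I_N => val k) a1U) => i iU0 imax.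
have iU : i \in U := iU0; rewrite !inE in iU.
have Ui (X : {set 'I_N}) : X \subset U -> forall k, k \in X -> (k <= i)%N.
  by move=> XU k kX; apply: imax; exact: (subsetP XU).
have [A1U B2U A2U B1U] : [/\ A1 \subset U, B2 \subset U, A2 \subset U & B1 \subset U].
  by split; apply/subsetP => k; rewrite !inE => ->; rewrite ?orbT.
case/orP: iU => /orP[iX|iX].
- by rewrite gtn_eqF // (total_lt_prod iX b2P) //; apply: sepP iX (Ui _ _).
- by rewrite mulnC gtn_eqF // (total_lt_prod iX a1P) //; apply: sepP iX (Ui _ _).
- rewrite ltn_eqF // (total_lt_prod iX b1P) //.
    by apply: sepP iX (Ui _ _) => //; rewrite disjoint_sym.
  by apply: sepP iX (Ui _ _) => //; rewrite disjoint_sym.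
- rewrite [X in _ != X]mulnC ltn_eqF // (total_lt_prod iX a2P) //; apply: sepP iX (Ui _ _) => //.
  all: by rewrite disjoint_sym.
Qed.

(** The pairs [(I v, J v)] are the edges of a graph, two classes of which lie inside [A :|: B]. In
    each class the masses counted by [I] and by [J] agree: [a] times the total weight in [A] equals
    [b] times that in [B]. Cross-multiplying the two balances contradicts [total_prod_neq]. *)
Lemma no_tie (R : realFieldType) (V : finType) (act : {set V}) (c : V -> R) (I J : V -> 'I_N)
    (A B : {set 'I_N}) (a b : R) :
  (#|act| + 2 <= #|A| + #|B|)%N -> {in act, forall v, 0 < c v} ->
  {in act &, forall v v', I v != J v'} -> 0 < a -> 0 < b ->
  {in A, forall i, \sum_(v in act | I v == i) c v = a * (weight i)%:R} ->
  {in B, forall j, \sum_(v in act | J v == j) c v = b * (weight j)%:R} -> False.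
Proof.
move=> cardAB c0 IJ a0 b0 Aa Bb.
have w0 i : 0 < (weight i)%:R :> R by rewrite ltr0n.
have hit (K : V -> 'I_N) i x : 0 < x -> \sum_(v in act | K v == i) c v = x * (weight i)%:R ->
    exists2 v, v \in act & K v = i.
  move=> x0 e; have [v /andP[va /eqP Kv]|none] := pickP (fun v => (v \in act) && (K v == i)).
    by exists v.
  by move: e; rewrite big_pred0 // => /esym/eqP; rewrite mulf_eq0 !gt_eqF.
have AB i : i \in A -> i \in B -> False.
  move=> /Aa/(hit I _ _ a0)[v va vi] /Bb/(hit J _ _ b0)[v' va' vi'].
  by have := IJ _ _ va va'; rewrite vi vi' eqxx.
have dAB : [disjoint A & B].
  by rewrite disjoint_subset; apply/subsetP => i iA; rewrite !inE; apply/negP => /(AB _ iA).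
(* An index of [B] carries positive mass, so it is some [J v] and never an [I v]. *)
have IB j : j \in B -> \sum_(v in act | I v == j) c v = 0.
  move=> /Bb/(hit J _ _ b0)[v va vj]; apply: big_pred0 => v'; apply/negP => /andP[va' /eqP vj'].
  by have := IJ _ _ va' va; rewrite vj vj' eqxx.
have JA i : i \in A -> \sum_(v in act | J v == i) c v = 0.
  move=> /Aa/(hit I _ _ a0)[v va vi]; apply: big_pred0 => v'; apply/negP => /andP[va' /eqP vi'].
  by have := IJ _ _ va va'; rewrite vi vi' eqxx.
have [|comp [compE [x [y [xy inAB]]]]] :=
    @two_inner_classes _ [seq (I v, J v) | v <- enum act] (A :|: B).
  rewrite size_map -cardE cardsU (_ : A :&: B = set0) ?cards0 ?subn0 //.
  by apply/eqP; rewrite setI_eq0.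
have compIJ v : v \in act -> comp (I v) = comp (J v).
  by move=> va; apply: (compE (I v, J v)); apply: map_f; rewrite mem_enum.
pose cl z := [set t | comp t == comp z].
have mass (K : V -> 'I_N) z (D F : {set 'I_N}) d : cl z \subset D :|: F -> [disjoint D & F] ->
    {in D, forall i, \sum_(v in act | K v == i) c v = d * (weight i)%:R} ->
    {in F, forall i, \sum_(v in act | K v == i) c v = 0} ->
    \sum_(v in act | comp (K v) == comp z) c v = d * (total (D :&: cl z))%:R.
  move=> clDF dDF Dd F0.
  rewrite (partition_big K (mem (cl z))) /=; last by move=> v /andP[_]; rewrite inE.
  rewrite (bigID (mem D)) /= [X in _ + X]big1 ?addr0 => [|i /andP[icl iD]].
    rewrite natr_sum mulr_sumr; apply: eq_big => [i|i /andP[icl iD]].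
      by rewrite finset.in_setI andbC.
    rewrite -Dd //; apply: eq_bigl => v; case: (eqVneq (K v) i) => [->|]; rewrite ?andbF //.
    by move: icl; rewrite inE => ->; rewrite !andbT.
  have iF : i \in F by have := subsetP clDF _ icl; rewrite inE (negPf iD).
  rewrite -[RHS](F0 _ iF); apply: eq_bigl => v; case: (eqVneq (K v) i) => [->|]; rewrite ?andbF //.
  by move: icl; rewrite inE => ->; rewrite !andbT.
have balance z : cl z \subset A :|: B ->
    a * (total (A :&: cl z))%:R = b * (total (B :&: cl z))%:R.
  move=> clAB; rewrite -(mass I z A B) // -(mass J z B A) //; last first.
  - by rewrite disjoint_sym.
  - by rewrite setUC.
  - by apply: eq_bigl => v; case va: (v \in act) => //=; rewrite compIJ.
(* A class inside [A :|: B] meets one of the two sets; its balance then forces it to meet the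
   other. *)
have nonempty z : cl z \subset A :|: B -> A :&: cl z != set0 /\ B :&: cl z != set0.
  move=> clAB; have := balance z clAB; have zcl : z \in cl z by rewrite inE.
  have pos (X : {set 'I_N}) : X != set0 -> (0 < total X)%N.
    by case/set0Pn => i /total_ge; apply: leq_trans.
  have eq0 (X : {set 'I_N}) : X = set0 -> total X = 0%N by move=> ->; rewrite big_set0.
  have [A0|A0] := eqVneq (A :&: cl z) set0; have [B0|B0] := eqVneq (B :&: cl z) set0 => //.
  - have := subsetP clAB _ zcl; rewrite inE => /orP[zX _|zX _].
      by have := in_set0 z; rewrite -A0 inE zX zcl.
    by have := in_set0 z; rewrite -B0 inE zX zcl.
  - by rewrite (eq0 _ A0) mulr0 => /esym/eqP; rewrite mulf_eq0 !gt_eqF // ltr0n pos.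
  - by rewrite (eq0 _ B0) mulr0 => /eqP; rewrite mulf_eq0 !gt_eqF // ltr0n pos.
have [clx cly] : cl x \subset A :|: B /\ cl y \subset A :|: B.
  by split; apply/subsetP => t; rewrite inE => /eqP e; apply: inAB; [left|right].
have [A1 B1] := nonempty _ clx; have [A2 B2] := nonempty _ cly.
have clxy : [disjoint cl x & cl y].
  rewrite disjoint_subset; apply/subsetP => t; rewrite !inE => /eqP ->; exact: xy.
have dis (X Y X' Y' : {set 'I_N}) : [disjoint X & Y] || [disjoint X' & Y'] ->
    [disjoint X :&: X' & Y :&: Y'].
  by case/orP => d; apply: disjointWl (disjointWr _ d); rewrite ?subsetIl ?subsetIr.
have clyx : [disjoint cl y & cl x] by rewrite disjoint_sym.
have dBA : [disjoint B & A] by rewrite disjoint_sym.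
have : (total (A :&: cl x) * total (B :&: cl y) != total (A :&: cl y) * total (B :&: cl x))%N.
  by apply: total_prod_neq => //; apply: dis; rewrite ?clxy ?clyx ?dAB ?dBA ?orbT.
move/eqP; apply; apply/eqP; rewrite -(eqr_nat R) !natrM.
have ab0 : a * b != 0 by rewrite mulf_neq0 ?gt_eqF.
apply/eqP/(mulfI ab0).
by rewrite mulrACA [RHS]mulrACA (balance _ clx) (balance _ cly) mulrC.
Qed.

End Weight.

(** * The Borsuk-Ulam theorem on the cube *)

From mathcomp Require Import all_classical all_reals all_analysis.
Import numFieldNormedType.Exports.
Local Open Scope classical_set_scope.

Lemma tucker (m M : nat) (lab : {ffun 'I_m -> int} -> 'I_m * bool) :
  (forall v : {ffun 'I_m -> int}, (forall i, `|v i| <= M.+1%:Z) ->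
    (exists i, `|v i| = M.+1%:Z) -> lab [ffun i => - v i] = opp_label (lab v)) ->
  exists v w : {ffun 'I_m -> int}, [/\ forall i, `|v i| <= M.+1%:Z, forall i, `|w i| <= M.+1%:Z,
    forall i, `|v i - w i| <= 1 & lab w = opp_label (lab v)].
Proof.
move=> lab_antipodal; apply: contrapT => nvw; apply: (no_compl_absurd lab_antipodal).
by move=> v w vM wM vw; apply/eqP => e; apply: nvw; exists v, w.
Qed.

Section Cube.
Variable R : realType.

Lemma norm_rV_attained m (x : 'rV[R]_m) : x != 0 -> exists i, `|x| = `|x ord0 i|.
Proof.
by rewrite -normr_eq0 => /mx_norm_neq0[[i j] xij]; exists j; rewrite [LHS]xij /= (ord1 i).
Qed.

Lemma ler_coord_norm m (x : 'rV[R]_m) i : `|x ord0 i| <= `|x|.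
Proof.
rewrite [leRHS]/Num.norm /= mx_normrE.
exact: (le_bigmax _ (fun ij => `|x ij.1 ij.2|) (ord0, i)).
Qed.

Lemma norm_rV_leP m (x : 'rV[R]_m) e : 0 <= e -> reflect (forall i, `|x ord0 i| <= e) (`|x| <= e).
Proof.
move=> e0; apply: (iffP idP) => [xe i|xe]; first exact: le_trans (ler_coord_norm x i) xe.
by have [->|/norm_rV_attained[i ->]] := eqVneq x 0; rewrite ?normr0.
Qed.

Lemma compact_cube m : compact [set u : 'rV[R]_m | `|u| <= 1].
Proof.
apply: bounded_closed_compact.
  by exists 1; split=> // M M1 u /= /le_trans; apply; exact: ltW.
rewrite (_ : mkset _ = (fun u : 'rV[R]_m => `|u|) @^-1` [set x | x <= 1]) //.
by apply: closed_comp => [u _|]; [exact: norm_continuous|exact: closed_le].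
Qed.

(** Each point of the cube has a neighbourhood with its own mesh; compactness makes the mesh
    uniform. *)
Lemma cube_unif_continuous m n (f : 'rV[R]_m -> 'rV[R]_n) e : continuous f -> 0 < e ->
  exists M : nat, forall u v, `|u| <= 1 -> `|u - v| <= M.+1%:R^-1 -> `|f u - f v| < e.
Proof.
move=> cf e0.
pose P (M : nat) (u : 'rV[R]_m) := forall v, `|u - v| <= M.+1%:R^-1 -> `|f u - f v| < e.
suff [M _ MP] : \forall M \near \oo, [set u : 'rV[R]_m | `|u| <= 1] `<=` P M.
  by exists M => u v u1; apply: (MP M (leqnn M)).
move/compact_near_coveringP: (@compact_cube m); apply => u0 _.
have /cvgrPdist_lt/(_ (e / 2)) := cf u0; rewrite divr_gt0 // => /(_ isT).
move=> /nbhs_ballP[d /= d0 dP].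
have d2 : 0 < d / 2 by rewrite divr_gt0.
near=> u M; rewrite /P => v uv.
have bu : `|u0 - u| < d / 2.
  by near: u; apply: cvgr_dist_lt => //.
have Md : (M.+1%:R^-1 : R) < d / 2.
  by near: M; exact: near_infty_natSinv_lt (PosNum d2).
have -> : f u - f v = (f u0 - f v) - (f u0 - f u) by rewrite opprB [RHS]addrC subrKA.
rewrite (le_lt_trans (ler_normB _ _)) // [e]splitr ltrD //; apply: dP; rewrite -ball_normE /=.
  rewrite -(subrKA u) (le_lt_trans (ler_normD _ _)) // [d]splitr ltrD //.
  exact: le_lt_trans uv Md.
by rewrite (lt_trans bu) // ltr_pdivrMr // ltr_pMr // ltr1n.
Unshelve. all: by end_near. Qed.

Lemma cube_norm_ge m n (f : 'rV[R]_m -> 'rV[R]_n) : continuous f ->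
  (forall u, `|u| <= 1 -> f u != 0) ->
  exists2 d, 0 < d & forall u, `|u| <= 1 -> d <= `|f u|.
Proof.
move=> cf f0; have [||c] := @EVT_min_rV R m (fun u => `|f u|) _ _ (@compact_cube m).
- by exists 0 => /=; rewrite normr0.
- apply: continuous_subspaceT => u.
  exact: (continuous_comp (@cf u) (@norm_continuous _ _ (f u))).
rewrite inE /= => c1 cP; exists `|f c|; first by rewrite normr_gt0 f0.
by move=> u u1; apply: cP; rewrite inE.
Qed.

Definition grid_pt m (M : nat) (v : {ffun 'I_m -> int}) : 'rV[R]_m :=
  \row_i ((v i)%:~R / M.+1%:R).

Lemma grid_pt_norm m M (v : {ffun 'I_m -> int}) :
  (forall i, `|v i| <= M.+1%:Z) -> `|grid_pt M v| <= 1.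
Proof.
move=> vM; apply/norm_rV_leP => // i; rewrite mxE normrM normfV -intr_norm.
by rewrite [`|M.+1%:R|]ger0_norm // ler_pdivrMr // mul1r pmulrn ler_int; exact: vM.
Qed.

Lemma grid_pt_adj m M (v w : {ffun 'I_m -> int}) :
  (forall i, `|v i - w i| <= 1) -> `|grid_pt M v - grid_pt M w| <= M.+1%:R^-1.
Proof.
move=> vw; apply/norm_rV_leP => // i; rewrite !mxE -mulrBl normrM normfV -intrB -intr_norm.
by rewrite [`|M.+1%:R|]ger0_norm // ler_pdivrMr // mulVf // lerz1.
Qed.

Lemma grid_ptN m M (v : {ffun 'I_m -> int}) : grid_pt M [ffun i => - v i] = - grid_pt M v.
Proof. by apply/rowP => i; rewrite !mxE ffunE mulrNz mulNr. Qed.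

(** Without a zero, [|f|] is at least some [d > 0] on the cube. On a grid so fine that [f] varies by
    less than [d] between neighbours, each point is labelled by a coordinate of absolute value at
    least [d] and its sign. A complementary pair from Tucker's lemma makes that coordinate vary by
    at least [2d]. *)
Lemma borsuk_ulam_cube m (f : 'rV[R]_m -> 'rV[R]_m) : continuous f ->
  (forall u, `|u| = 1 -> f (- u) = - f u) -> exists2 u, `|u| <= 1 & f u = 0.
Proof.
move=> cf oddf; apply: contrapT => f0.
have {}f0 u : `|u| <= 1 -> f u != 0 by move=> u1; apply/eqP => fu0; apply: f0; exists u.
have [d d0 dP] := cube_norm_ge cf f0.
have [M MP] := cube_unif_continuous cf d0.
have large u : `|u| <= 1 -> exists i, d <= `|f u ord0 i|.
  by move=> u1; have [i fui] := norm_rV_attained (f0 _ u1); exists i; rewrite -fui dP.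
have [i0 _] : exists i, d <= `|f 0 ord0 i| by apply: large; rewrite normr0.
(* The choice looks only at absolute values, so [x] and [- x] get the same index; the default [i0]
   is never reached at images of points of the cube. *)
pose big (x : 'rV[R]_m) := odflt i0 [pick i | d <= `|x ord0 i|].
have bigN x : big (- x) = big x.
  by rewrite /big; congr odflt; apply: eq_pick => i; rewrite mxE normrN.
pose lab (v : {ffun 'I_m -> int}) := let x := f (grid_pt M v) in (big x, 0 < x ord0 (big x)).
have bigP (v : {ffun 'I_m -> int}) : (forall i, `|v i| <= M.+1%:Z) ->
    d <= `|f (grid_pt M v) ord0 (big (f (grid_pt M v)))|.
  move=> vM; rewrite /big; case: pickP => [//|nd].
  by have [i] := large _ (grid_pt_norm vM); rewrite nd.
have [v [w [vM wM vw lvw]]] : exists v w : {ffun 'I_m -> int},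
    [/\ forall i, `|v i| <= M.+1%:Z, forall i, `|w i| <= M.+1%:Z,
        forall i, `|v i - w i| <= 1 & lab w = opp_label (lab v)].
  apply: tucker => v vM [j vj].
  have fv : f (grid_pt M [ffun i => - v i]) = - f (grid_pt M v).
    rewrite grid_ptN oddf //; apply/eqP; rewrite eq_le grid_pt_norm //=.
    apply: le_trans (ler_coord_norm _ j).
    rewrite mxE normrM normfV -intr_norm vj -pmulrn ger0_norm // divff //.
  (* Negating [x] negates the test [0 < x] only because the chosen coordinate is nonzero. *)
  rewrite /lab /= fv bigN /opp_label /= mxE oppr_gt0 -leNgt le_eqVlt.
  case: eqP => //= x0; have := bigP _ vM; rewrite x0 normr0 leNgt d0 //.
have := bigP _ vM; have := bigP _ wM; move: lvw; rewrite /lab /opp_label /=.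
move=> [-> sgn]; set i := big _ in sgn *.
have := le_lt_trans (ler_coord_norm (f (grid_pt M v) - f (grid_pt M w)) i)
  (MP _ _ (grid_pt_norm vM) (grid_pt_adj M vw)).
rewrite !mxE; move: sgn; set x := f _ _ _; set y := f _ _ _.
case: (ltrP 0 x); case: (ltrP 0 y) => // y0 x0 _.
  by rewrite (gtr0_norm x0) (ler0_norm y0) ltr_norml => /andP[]; lra.
by rewrite (gtr0_norm y0) (ler0_norm x0) ltr_norml => /andP[]; lra.
Qed.

End Cube.

(** * Hat functions of the Kuhn triangulation *)

Section Continuity.
Variables (R : realType) (U : topologicalType).

Lemma continuous_row n (F : U -> 'I_n -> R) : (forall i, continuous (F^~ i)) ->
  continuous (fun u => \row_i F u i : 'rV[R]_n).
Proof.
move=> cF u; apply/cvgrPdist_le => e e0.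
apply: filterS (_ : \forall t \near u, forall i : 'I_n, `|F u i - F t i| <= e).
  by move=> t Ft; apply/norm_rV_leP => [|i]; [exact: ltW|rewrite !mxE].
apply: filter_forall => i; have /cvgrPdist_le/(_ e e0) := cF i u; exact.
Qed.

(** The neutral element may depend on the point, as it does in the minimum inside [threshold]. *)
Lemma continuous_big (I : Type) (op : R -> R -> R) idx (r : seq I) (P : pred I) (F : U -> I -> R) :
  (forall f g : U -> R, continuous f -> continuous g -> continuous (fun u => op (f u) (g u))) ->
  continuous idx -> (forall i, continuous (F^~ i)) ->
  continuous (fun u => \big[op/idx u]_(i <- r | P i) F u i).
Proof.
move=> cop cidx cF; elim: r => [|i r IHr].
  by rewrite (_ : (fun _ => _) = idx) //; apply/funext => u; rewrite big_nil.
rewrite (_ : (fun _ => _) = fun u => if P i then op (F u i) (\big[op/idx u]_(j <- r | P j) F u j)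
                               else \big[op/idx u]_(j <- r | P j) F u j); last first.
  by apply/funext => u; rewrite big_cons.
by case: (P i) => //; apply: cop.
Qed.

Lemma continuous_bigprod (I : Type) (r : seq I) (P : pred I) (F : U -> I -> R) :
  (forall i, continuous (F^~ i)) -> continuous (fun u => \prod_(i <- r | P i) F u i).
Proof.
apply: (@continuous_big _ _ (fun=> 1)); last exact: cst_continuous.
by move=> f g cf cg u; apply: cvgM; [exact: cf|exact: cg].
Qed.

Lemma continuous_bigsum (I : Type) (r : seq I) (P : pred I) (F : U -> I -> R) :
  (forall i, continuous (F^~ i)) -> continuous (fun u => \sum_(i <- r | P i) F u i).
Proof.
apply: (@continuous_big _ _ (fun=> 0)); last exact: cst_continuous.
by move=> f g cf cg u; apply: cvgD; [exact: cf|exact: cg].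
Qed.

Lemma continuous_sub2 (V : normedModType R) (f g : U -> V) : continuous f -> continuous g ->
  continuous (fun u => f u - g u).
Proof. by move=> cf cg u; apply: cvgB; [exact: cf|exact: cg]. Qed.

Lemma continuous_mul2 (f g : U -> R) : continuous f -> continuous g ->
  continuous (fun u => f u * g u).
Proof. by move=> cf cg u; apply: cvgM; [exact: cf|exact: cg]. Qed.

Lemma continuous_norm1 (V : normedModType R) (f : U -> V) : continuous f ->
  continuous (fun u => `|f u|).
Proof. by move=> cf u; apply: cvg_norm; exact: cf. Qed.

Lemma continuous_max2 (f g : U -> R) : continuous f -> continuous g ->
  continuous (fun u => Num.max (f u) (g u)).
Proof. by move=> cf cg u; apply: continuous_max; [exact: cf|exact: cg]. Qed.

Lemma continuous_min2 (f g : U -> R) : continuous f -> continuous g ->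
  continuous (fun u => Num.min (f u) (g u)).
Proof. by move=> cf cg u; apply: continuous_min; [exact: cf|exact: cg]. Qed.

Lemma continuous_coord n (k : U -> 'rV[R]_n) i : continuous k ->
  continuous (fun u => k u ord0 i).
Proof.
move=> ck u; apply: (@continuous_comp _ _ _ k (fun z : 'rV[R]_n => z ord0 i)); first exact: ck.
exact: coord_continuous.
Qed.

Lemma continuous_within_comp (V W : topologicalType) (A : set V) (k : U -> V) (g : V -> W) :
  continuous k -> (forall u, A (k u)) -> {within A, continuous g} -> continuous (g \o k).
Proof.
move=> ck Ak /subspace_continuousP cg u.
apply: (@cvg_comp _ _ _ k g (nbhs u) (within A (nbhs (k u)))); last exact: cg.
by move=> B Bk; apply: (@filterS _ (nbhs u) _ _ _ _ (ck u _ Bk)) => t /=; apply; exact: Ak.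
Qed.

End Continuity.

(** * Vertices, hat functions and active sets *)

Section Hat.
Variables (R : realType) (m M : nat).
Local Notation V := {ffun 'I_m -> 'I_(M.+1.*2).+1}.

(** Indices from 0 to [2(M + 1)] instead of signed integers make the vertices a finite type, over
    which sums can run. *)
Definition vtx (v : V) : 'rV[R]_m := \row_i ((v i)%:R / M.+1%:R - 1).
Definition offset (v : V) (u : 'rV[R]_m) i : R := M.+1%:R * (u ord0 i - vtx v ord0 i).
(* Positive exactly where the hat function of v in the Kuhn triangulation is; it
   is not normalised to a partition of unity because only rays matter below. *)
Definition hat (v : V) (u : 'rV[R]_m) : R :=
  \prod_i Num.max 0 (1 - `|offset v u i|) *
  \prod_i \prod_j Num.max 0 (1 - (offset v u i - offset v u j)).
Definition opp_vtx (v : V) : V := [ffun i => rev_ord (v i)].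

Lemma opp_vtxK : involutive opp_vtx.
Proof. by move=> v; apply/ffunP => i; rewrite !ffunE rev_ordK. Qed.

Let M0 : M.+1%:R != 0 :> R. Proof. by rewrite pnatr_eq0. Qed.

Let M2 : (M.+1.*2)%:R = 2 * M.+1%:R :> R. Proof. by rewrite -mul2n natrM. Qed.

Lemma offsetE v u i : offset v u i = M.+1%:R * (u ord0 i + 1) - (v i)%:R.
Proof. by rewrite /offset mxE; move: M0; set k := M.+1%:R => k0; field. Qed.

Lemma vtxN v : vtx (opp_vtx v) = - vtx v.
Proof.
apply/rowP => i; rewrite !mxE ffunE /= subSS natrB; last by rewrite -ltnS.
by rewrite M2; move: M0; set k := M.+1%:R => k0; field.
Qed.

Lemma offsetN v u i : offset (opp_vtx v) (- u) i = - offset v u i.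
Proof. by rewrite /offset vtxN !mxE; ring. Qed.

Lemma hatN v u : hat (opp_vtx v) (- u) = hat v u.
Proof.
rewrite /hat; congr (_ * _); first by apply: eq_bigr => i _; rewrite offsetN normrN.
rewrite exchange_big; apply: eq_bigr => i _; apply: eq_bigr => j _.
by rewrite !offsetN opprK [- offset _ _ _ + _]addrC.
Qed.

Lemma hat_ge0 v u : 0 <= hat v u.
Proof.
have max_ge0 (x : R) : 0 <= Num.max 0 x by rewrite le_max lexx.
by apply: mulr_ge0; apply: prodr_ge0 => i _ //; apply: prodr_ge0.
Qed.

Lemma hat_gt0P v u : reflect ((forall i, `|offset v u i| < 1) /\
  forall i j, offset v u i - offset v u j < 1) (0 < hat v u).
Proof.
have maxE (x : R) : (0 < Num.max 0 (1 - x)) = (x < 1) by rewrite lt_max ltxx subr_gt0.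
have maxE0 (x : R) : (Num.max 0 (1 - x) == 0) = ~~ (x < 1).
  by rewrite -maxE -leNgt eq_le [0 <= _]le_max lexx andbT.
apply: (iffP idP) => [|[w1 w2]]; last first.
  apply: mulr_gt0; apply: prodr_gt0 => i _; first by rewrite maxE.
  by apply: prodr_gt0 => j _; rewrite maxE.
move=> h0; have : hat v u != 0 by rewrite gt_eqF.
rewrite mulf_eq0 negb_or => /andP[/prodf_neq0 w1 /prodf_neq0 w2]; split=> [i|i j].
  by have := w1 i isT; rewrite maxE0 negbK.
by have /prodf_neq0/(_ j isT) := w2 i isT; rewrite maxE0 negbK.
Qed.

Lemma hat_eq0 v u : ~~ (0 < hat v u) -> hat v u = 0.
Proof. by rewrite -leNgt le_eqVlt ltNge hat_ge0 orbF => /eqP. Qed.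

Lemma continuous_offset v i : continuous (fun u => offset v u i).
Proof.
apply: continuous_mul2; first exact: cst_continuous.
by apply: continuous_sub2; [exact: coord_continuous|exact: cst_continuous].
Qed.

Lemma continuous_hat v : continuous (hat v).
Proof.
have cmax (f : 'rV[R]_m -> R) : continuous f -> continuous (fun u => Num.max 0 (1 - f u)).
  move=> cf; apply: continuous_max2; first exact: cst_continuous.
  by apply: continuous_sub2; [exact: cst_continuous|exact: cf].
apply: continuous_mul2.
  apply: continuous_bigprod => i; apply: cmax.
  by apply: continuous_norm1; exact: continuous_offset.
apply: continuous_bigprod => i; apply: continuous_bigprod => j; apply: cmax.
by apply: continuous_sub2; exact: continuous_offset.
Qed.

Lemma vtx_norm v : `|vtx v| <= 1.
Proof.
apply/norm_rV_leP => // i; rewrite mxE ler_norml lerBrDl subrr lerBlDr.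
rewrite divr_ge0 //= ler_pdivrMr // -[1 + 1]/(2%:R) -natrM ler_nat mul2n.
by rewrite -ltnS ltn_ord.
Qed.

Lemma hat_near v w u i : 0 < hat v u -> 0 < hat w u -> (v i <= (w i).+1)%N.
Proof.
move=> /hat_gt0P[+ _] /hat_gt0P[+ _] => /(_ i) + /(_ i).
rewrite !offsetE !ltr_norml => /andP[v1 v2] /andP[w1 w2].
rewrite -ltnS -(ltr_nat R) -2!natr1; lra.
Qed.

Lemma hat_vtx_near v w u : 0 < hat v u -> 0 < hat w u -> `|vtx v - vtx w| <= M.+1%:R^-1.
Proof.
move=> hv hw; apply/norm_rV_leP => // i; rewrite !mxE.
rewrite (_ : _ - _ = ((v i)%:R - (w i)%:R) / M.+1%:R); last by rewrite mulrBl; ring.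
rewrite normrM normfV [`|M.+1%:R|]ger0_norm // ler_pdivrMr // mulVf //.
have := hat_near i hv hw; have := hat_near i hw hv.
rewrite -!(ler_nat R) -!natr1 ler_norml; lra.
Qed.

(** Some coordinate of [u] is 1 or -1, a grid value at the end of its range; a vertex less than one
    mesh away has the same coordinate. *)
Lemma hat_boundary v u : 0 < hat v u -> `|u| = 1 -> `|vtx v| = 1.
Proof.
move=> /hat_gt0P[+ _] u1; have u0 : u != 0 by rewrite -normr_eq0 u1 oner_eq0.
have [i ui] := norm_rV_attained u0 => /(_ i).
rewrite offsetE => vi; apply/eqP; rewrite eq_le vtx_norm /=.
apply: le_trans (ler_coord_norm _ i); rewrite mxE.
have := ltn_ord (v i) => vM; move: vi; rewrite ltr_norml => /andP[vi1 vi2].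
move: ui; rewrite u1; case: (lerP 0 (u ord0 i)) => [ui0 ui|ui0 ui].
  rewrite ger0_norm // in ui; rewrite -ui in vi1 vi2.
  have -> : v i = M.+1.*2 :> nat.
    apply/eqP; rewrite eqn_leq -ltnS vM /= -ltnS -(ltr_nat R) M2 -natr1; lra.
  by rewrite M2 mulfK // ler_normr; apply/orP; left; lra.
have ui' : u ord0 i = -1 by rewrite ui ltr0_norm // opprK.
rewrite ui' addNr mulr0 in vi1 vi2.
have -> : v i = 0%N :> nat.
  by apply/eqP; rewrite -leqn0 -ltnS -(ltr_nat R); lra.
by rewrite mul0r sub0r normrN normr1.
Qed.

(** Rounding each coordinate down gives offsets in [[0, 1[], whose differences are below 1. *)
Lemma hat_exists u : `|u| <= 1 -> exists v, 0 < hat v u.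
Proof.
move=> u1; pose x i : R := M.+1%:R * (u ord0 i + 1).
have ui i : -1 <= u ord0 i <= 1 by rewrite -ler_norml; apply: le_trans (ler_coord_norm u i) u1.
have x0 i : 0 <= x i by rewrite mulr_ge0 //; have := ui i; lra.
pose v : V := [ffun i => inord (Num.truncn (x i))].
have offE i : offset v u i = x i - (Num.truncn (x i))%:R.
  rewrite offsetE ffunE inordK // ltnS -mul2n -(ler_nat R).
  apply: (@le_trans _ _ (x i)); first by rewrite truncn_le.
  by rewrite natrM [leRHS]mulrC ler_pM2l ?ltr0n //; have := ui i; lra.
have off i : 0 <= offset v u i < 1.
  rewrite offE subr_ge0 truncn_le x0 /= ltrBlDl.
  by have := truncnS_gt (x i); rewrite -natr1.
exists v; apply/hat_gt0P; split=> [i|i j]; have := off i.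
  by case/andP=> o1 o2; rewrite ger0_norm.
by have := off j; lra.
Qed.

Definition active u : {set V} := [set v | (0 < hat v u)%R]%SET.

(* Active vertices form a chain for the product order, with all coordinates
   differing by at most 1, so the sum of coordinates separates them. *)
Lemma card_active u : (#|active u| <= m.+1)%N.
Proof.
set act := active u.
have [->|[v1 v1a]] := set_0Vmem act; first by rewrite cards0.
pose tot (v : V) := (\sum_i v i)%N.
case: (arg_minnP tot v1a) => v0 v0a v0min.
have hact v : v \in act -> 0 < hat v u by rewrite inE.
have {}v0a : v0 \in act := v0a.
(* If [v] exceeds [w] at [i] and [w] exceeds [v] at [j], two offset differences add up to at least
   2, yet each is below 1. *)
have chain (v w : V) : v \in act -> w \in act ->
    (forall i, v i <= w i)%N \/ (forall i, w i <= v i)%N.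
  move=> /hact/hat_gt0P[_ va] /hact/hat_gt0P[_ wa].
  have [/forallP le|/forallPn[i]] := boolP [forall i, v i <= w i]%N; first by left.
  rewrite -ltnNge => wvi; right=> j; rewrite leqNgt; apply/negP => vwj.
  have := va j i; have := wa i j; rewrite !offsetE.
  by move: wvi vwj; rewrite -!(ler_nat R) -!natr1; lra.
have le_eq (v w : V) : (forall i, v i <= w i)%N -> tot v = tot w -> v = w.
  move=> le e; apply/ffunP => i; apply/val_inj/eqP; rewrite eqn_leq le /=.
  rewrite leqNgt; apply/negP => lti; have : (tot v < tot w)%N; last by rewrite e ltnn.
  rewrite /tot (bigD1 i) // [ltnRHS](bigD1 i) //= -addSn leq_add //.
  by apply: leq_sum.
(* An active vertex exceeds the minimal one by at most 1 in each of the [m] coordinates, so the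
   difference of sums fits in ['I_m.+1]. *)
pose rk (v : V) : 'I_m.+1 := inord (tot v - tot v0).
have rkE v : v \in act -> rk v = (tot v - tot v0)%N :> nat.
  move=> va; rewrite inordK // ltnS leq_subLR -[X in (_ + X)%N]card_ord -sum1_card -big_split /=.
  by apply: leq_sum => i _; rewrite addn1; apply: hat_near (hact _ va) (hact _ v0a).
rewrite -[X in (_ <= X)%N]card_ord -(@card_in_imset _ _ rk act); first exact: max_card.
move=> v w va wa /(congr1 val); rewrite /= !rkE //.
have := v0min _ va; have := v0min _ wa => w0 v0' e.
have {}e : tot v = tot w by lia.
by case: (chain v w va wa) => le; [exact: le_eq|apply/esym/le_eq].
Qed.

End Hat.

(** * Truncation to a skeleton and radial extension *)

Section Truncation.
Variables (R : realType) (N d : nat).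
Implicit Types z : 'rV[R]_N.

(* The (d+2)-nd largest coordinate of z >= 0 (0 if N < d + 2); `|z| is an upper
   bound serving as neutral element of the minimum. *)
Definition threshold z : R :=
  \big[Num.max/0]_(A : {set 'I_N} | #|A| == d.+2) \big[Num.min/`|z|]_(i in A) z ord0 i.

Definition truncation z : 'rV[R]_N := \row_i Num.max 0 (z ord0 i - threshold z).

Definition supp z : {set 'I_N} := [set i | (0 < z ord0 i)%R]%SET.

Lemma truncation_ge0 z i : 0 <= truncation z ord0 i.
Proof. by rewrite mxE le_max lexx. Qed.

Lemma threshold_ge0 z : 0 <= threshold z.
Proof. exact: bigmax_ge_id. Qed.

Lemma truncation_gt0 z i : (0 < truncation z ord0 i) = (threshold z < z ord0 i).
Proof. by rewrite mxE lt_max ltxx subr_gt0. Qed.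

(** If [d + 2] coordinates exceeded the threshold, so would their minimum, which is one of the
    candidates in the maximum. *)
Lemma card_supp_truncation z : (#|supp (truncation z)| <= d.+1)%N.
Proof.
rewrite leqNgt; apply/negP => /card_geqP[s [us ss sS]].
pose A := [set:: s]%SET.
have cA : #|A| == d.+2 by rewrite cardsE (card_uniqP us) ss.
have zA i : i \in A -> threshold z < z ord0 i.
  by rewrite inE => /sS; rewrite inE truncation_gt0.
suff : threshold z < threshold z by rewrite ltxx.
rewrite {2}/threshold; apply: lt_le_trans (le_bigmax_cond _ _ cA).
(* The neutral element of the minimum must exceed the threshold too: it bounds a coordinate in the
   nonempty set [A]. *)
apply/bigmin_gtP; split=> //; have /card_gt0P[i iA] : (0 < #|A|)%N by rewrite (eqP cA).
apply: lt_le_trans (zA i iA) _; apply: le_trans (ler_norm _) (ler_coord_norm _ _).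
Qed.

(** The threshold then bounds every coordinate, hence is positive, and it is reached as the minimum
    over some [A], where all coordinates must equal it. *)
Lemma truncation_eq0 z : (forall i, 0 <= z ord0 i) -> z != 0 -> truncation z = 0 ->
  exists (A : {set 'I_N}) (a : R), [/\ #|A| = d.+2, 0 < a & {in A, forall i, z ord0 i = a}].
Proof.
move=> z0 zn0 tz0.
have zt i : z ord0 i <= threshold z by rewrite leNgt -truncation_gt0 tz0 mxE ltxx.
have t0 : 0 < threshold z.
  rewrite lt_neqAle threshold_ge0 andbT; apply: contraNneq zn0 => te.
  by apply/eqP/rowP => i; rewrite mxE; apply/le_anti; rewrite z0 te zt.
have /bigmax_geP[|[A /eqP cA /bigmin_geP[_ Az]]] : threshold z <= threshold z by [].
  by rewrite leNgt t0.
by exists A, (threshold z); split=> // i iA; apply/le_anti; rewrite zt Az.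
Qed.

Lemma supp_truncation z : supp (truncation z) \subset supp z.
Proof.
apply/fintype.subsetP => i; rewrite !inE truncation_gt0; exact/le_lt_trans/threshold_ge0.
Qed.

Lemma continuous_truncation (U : topologicalType) (k : U -> 'rV[R]_N) :
  continuous k -> continuous (fun u => truncation (k u)).
Proof.
move=> ck; have ci i := @continuous_coord _ _ _ _ i ck.
apply: continuous_row => i; apply: continuous_max2; first exact: cst_continuous.
apply: continuous_sub2; first exact: ci.
apply: continuous_big; [exact: continuous_max2|exact: cst_continuous|move=> A].
by apply: continuous_big => //; [exact: continuous_min2|exact: continuous_norm1].
Qed.

End Truncation.

(** * Radial extension of a map to the cone *)

Section Cone.
Variables (R : realType) (N n : nat).
Implicit Types z : 'rV[R]_N.

Definition mass z : R := \sum_i z ord0 i.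
Definition normalize z := (mass z)^-1 *: z.
(* As mass 0 = 0, this is 0 at z = 0 although normalize 0 is junk. *)
Definition cone (f : 'rV[R]_N -> 'rV[R]_n) z := mass z *: f (normalize z).

Lemma mass_eq0 z : (forall i, 0 <= z ord0 i) -> (mass z == 0) = (z == 0).
Proof.
move=> z0; apply/eqP/eqP => [/eqP|->]; last by rewrite /mass big1 // => i; rewrite mxE.
rewrite psumr_eq0 // => /allP zi; apply/rowP => i; rewrite mxE.
by apply/eqP; apply: zi; rewrite mem_index_enum.
Qed.

Lemma continuous_mass (U : topologicalType) (k : U -> 'rV[R]_N) :
  continuous k -> continuous (fun u => mass (k u)).
Proof.
by move=> ck; apply: continuous_bigsum => i; exact: continuous_coord.
Qed.

(** Where the mass vanishes, continuity follows from the bound of [|cone f|] by the mass; elsewhere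
    [normalize] is continuous and nearby points stay in [A]. *)
Lemma continuous_cone (U : topologicalType) (k : U -> 'rV[R]_N) (A : set 'rV[R]_N)
    (f : 'rV[R]_N -> 'rV[R]_n) :
  continuous k -> (forall u i, 0 <= k u ord0 i) -> (forall u, k u != 0 -> A (normalize (k u))) ->
  {within A, continuous f} -> (forall x, A x -> `|f x| <= 1) ->
  continuous (fun u => cone f (k u)).
Proof.
move=> ck k0 Ak /subspace_continuousP cf f1 u.
have cm := continuous_mass ck.
have m0 t : 0 <= mass (k t) by apply: sumr_ge0.
have cone_le t : `|cone f (k t)| <= mass (k t).
  have [kt0|ktn0] := eqVneq (mass (k t)) 0; first by rewrite /cone kt0 scale0r normr0.
  rewrite /cone normrZ ger0_norm // ler_piMr // f1 //; apply: Ak.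
  by rewrite -mass_eq0.
have [ku0|kun0] := eqVneq (mass (k u)) 0.
  have cu0 : cone f (k u) = 0 by rewrite /cone ku0 scale0r.
  apply/cvgrPdist_lt => e e0; have /cvgrPdist_lt/(_ e e0) := cm u.
  apply: filterS => t; rewrite /= ku0 cu0 !sub0r !normrN ger0_norm //; exact: le_lt_trans.
apply: cvgZ; first exact: cm.
apply: (@cvg_comp _ _ _ (normalize \o k) f (nbhs u)
  (within A (nbhs (normalize (k u))))); last first.
  by apply: cf; apply: Ak; rewrite -mass_eq0.
have cn : (normalize \o k) x @[x --> u] --> normalize (k u).
  by apply: cvgZ; [apply: cvgV; [|exact: cm]|exact: ck].
have near0 : \forall t \near u, k t != 0.
  have /cvgrPdist_lt/(_ (mass (k u))) := cm u; rewrite lt_neqAle eq_sym kun0 m0 => /(_ isT).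
  apply: filterS => t; rewrite -mass_eq0 //; apply: contraTneq => ->.
  by rewrite subr0 ger0_norm // ltxx.
move=> B Bk; have := cn _ Bk; rewrite /= => Bt.
by apply: filterS2 near0 Bt => t kt; apply; exact: Ak.
Qed.

End Cone.

(** * Non-embeddability *)

Section ToSphere.
Variables (R : realType) (m : nat).

Definition sqnorm n (x : 'rV[R]_n) : R := \sum_i x ord0 i ^+ 2.

Lemma sqnorm_gt0 n (x : 'rV[R]_n) : x != 0 -> 0 < sqnorm x.
Proof.
move=> x0; rewrite lt_neqAle sumr_ge0 ?andbT => [|i _]; last exact: sqr_ge0.
apply: contraNneq x0 => /esym/eqP; rewrite psumr_eq0 => [/allP xi|i _]; last exact: sqr_ge0.
apply/eqP/rowP => i; rewrite mxE; apply/eqP; rewrite -sqrf_eq0; apply: xi.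
by rewrite mem_index_enum.
Qed.

Lemma sqnormZ n a (x : 'rV[R]_n) : sqnorm (a *: x) = a ^+ 2 * sqnorm x.
Proof. by rewrite /sqnorm mulr_sumr; apply: eq_bigr => i _; rewrite mxE exprMn. Qed.

(** The cube is lifted to height [1 - |u|], in the sup norm, so that its boundary lands on the
    equator, where [u] and [- u] become antipodal. *)
Definition hemisphere (u : 'rV[R]_m) : 'rV[R]_m.+1 :=
  \row_j (if unlift ord0 j is Some i then u ord0 i else 1 - `|u|).

Definition to_sphere (u : 'rV[R]_m) : 'rV[R]_m.+1 :=
  (Num.sqrt (sqnorm (hemisphere u)))^-1 *: hemisphere u.

Lemma hemisphere_neq0 u : hemisphere u != 0.
Proof.
apply/eqP => /rowP u0; have := u0 ord0; rewrite !mxE unlift_none.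
move=> /eqP; rewrite subr_eq0 => /eqP u1.
have /norm_rV_attained[i] : u != 0 by rewrite -normr_eq0 -u1 oner_eq0.
by have := u0 (lift ord0 i); rewrite !mxE liftK => ->; rewrite -u1 normr0 => /eqP; rewrite oner_eq0.
Qed.

Lemma to_sphere_in u : unit_sphere R m (to_sphere u).
Proof.
have h0 := sqnorm_gt0 (hemisphere_neq0 u).
change (sqnorm (to_sphere u) = 1).
by rewrite sqnormZ exprVn sqr_sqrtr ?mulVf ?gt_eqF // ltW.
Qed.

Lemma to_sphereN u : `|u| = 1 -> to_sphere (- u) = - to_sphere u.
Proof.
move=> u1; have hN : hemisphere (- u) = - hemisphere u.
  by apply/rowP => j; rewrite !mxE normrN u1 subrr; case: unlift => [i|]; rewrite ?mxE ?oppr0.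
rewrite /to_sphere hN scalerN; congr (- (_ *: _)); congr (_ ^-1); congr Num.sqrt.
by apply: eq_bigr => i _; rewrite mxE sqrrN.
Qed.

Lemma continuous_to_sphere : continuous to_sphere.
Proof.
have ch : continuous hemisphere.
  apply: continuous_row => j; case: unlift => [i|]; first exact: coord_continuous.
  apply: continuous_sub2; first exact: cst_continuous.
  by apply: continuous_norm1 => u; exact: cvg_id.
have chi i := @continuous_coord _ _ _ _ i ch.
have cs : continuous (fun u => Num.sqrt (sqnorm (hemisphere u))).
  have cq : continuous (fun u => sqnorm (hemisphere u)).
    by apply: continuous_bigsum => i; apply: continuous_mul2; exact: chi.
  move=> u; apply: (@continuous_comp _ _ _ (fun u => sqnorm (hemisphere u)) Num.sqrt).
    exact: cq.
  exact: sqrt_continuous.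
move=> u; have h0 := sqnorm_gt0 (hemisphere_neq0 u).
apply: (@cvgZ _ _ _ (nbhs u)); last exact: ch.
by apply: cvgV; [rewrite gt_eqF // sqrtr_gt0|exact: cs].
Qed.

End ToSphere.

(** If the coordinate of largest absolute value is negative, the others sum to at least [e]; there
    are fewer than [N + 1] of them, so one reaches [e / (N + 1)]. *)
Lemma large_coord_sum0 (R : realType) N (x : 'rV[R]_N) e : 0 < e -> e <= `|x| ->
  \sum_i x ord0 i = 0 -> exists i, e / N.+1%:R <= x ord0 i.
Proof.
move=> e0 ex sumx; have x0 : x != 0 by rewrite -normr_gt0 (lt_le_trans e0).
have eN : e / N.+1%:R <= e by rewrite ler_pdivrMr // ler_peMr ?ler1n // ltW.
have [j xj] := norm_rV_attained x0; move: ex; rewrite xj => ex.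
have [xj0|xj0] := lerP 0 (x ord0 j).
  by exists j; apply: le_trans eN _; rewrite -(ger0_norm xj0).
apply: contrapT => /forallNP none; move/eqP: sumx; rewrite (bigD1 j) //=.
apply/negP; rewrite lt_eqF //.
have le : \sum_(i < N | i != j) x ord0 i <= \sum_(i < N | i != j) e / N.+1%:R.
  by apply: ler_sum => i _; apply: ltW; rewrite ltNge; exact/negP/none.
have lt : \sum_(i < N | i != j) e / N.+1%:R < e.
  rewrite sumr_const -[_ *+ #|_|]mulr_natr -mulrA gtr_pMr // mulrC ltr_pdivrMr // mul1r ltr_nat.
  by rewrite ltnS (leq_trans (max_card _)) // card_ord.
by move: ex; rewrite ltr0_norm // => ex; lra.
Qed.

(** * The antipodal gap and the contradiction *)

Section Obstruction.
Variables (R : realType) (d N : nat) (K : {set {set 'I_N}}).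
Local Notation m := (2 * d).+1.
Hypothesis Kcomplex : is_simplicial_complex K.
Variables (h : 'rV[R]_m.+1 -> 'rV[R]_N) (f : 'rV[R]_N -> 'rV[R]_m).
Hypothesis h_in : forall x, unit_sphere R m x -> geom_realization R K (h x).
Hypothesis h_inj : forall x y, unit_sphere R m x -> unit_sphere R m y -> h x = h y -> x = y.
Hypothesis h_cont : {within unit_sphere R m, continuous h}.
Local Notation skel := (geom_realization R (sc_skeleton K d)).
Hypothesis f_in : forall x, skel x -> unit_sphere R (2 * d) (f x).
Hypothesis f_inj : forall x y, skel x -> skel y -> f x = f y -> x = y.
Hypothesis f_cont : {within skel, continuous f}.

Definition gap (u : 'rV[R]_m) : 'rV[R]_N := h (to_sphere u) - h (- to_sphere u).

Let sphereN x : unit_sphere R m x -> unit_sphere R m (- x).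
Proof.
by move=> x1; rewrite /unit_sphere /= -[RHS]x1; apply: eq_bigr => i _; rewrite mxE sqrrN.
Qed.

Lemma gapN u : `|u| = 1 -> gap (- u) = - gap u.
Proof. by move=> u1; rewrite /gap to_sphereN // opprK opprB. Qed.

Lemma continuous_gap : continuous gap.
Proof.
have cN : continuous (fun u => - to_sphere u : 'rV[R]_m.+1).
  by move=> u; apply: (@cvgN _ _ _ (nbhs u)); exact: continuous_to_sphere.
apply: continuous_sub2.
  apply: continuous_within_comp h_cont => [|u]; first exact: continuous_to_sphere.
  exact: to_sphere_in.
by apply: continuous_within_comp h_cont => // u; exact/sphereN/to_sphere_in.
Qed.

Lemma gap_neq0 u : gap u != 0.
Proof.
rewrite subr_eq0; apply/eqP => e; have s1 := @to_sphere_in R m u.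
have := h_inj s1 (sphereN s1) e; move: s1; set x := to_sphere u => x1 /eqP.
rewrite -subr_eq0 opprK -mulr2n -scaler_nat scaler_eq0 pnatr_eq0 /= => /eqP x0.
move: x1; rewrite /unit_sphere /= x0 big1 => [/esym/eqP|i _]; first by rewrite oner_eq0.
by rewrite mxE expr0n.
Qed.

Lemma sum_gap u : \sum_i gap u ord0 i = 0.
Proof.
have s1 := @to_sphere_in R m u.
have [s _ [_ _ e]] := h_in s1; have [t _ [_ _ e']] := h_in (sphereN s1).
under eq_bigr do rewrite !mxE.
by rewrite sumrB e e' subrr.
Qed.

Lemma gap_carrier u : exists s t, [/\ s \in K, t \in K,
  forall i, 0 < gap u ord0 i -> i \in s & forall i, gap u ord0 i < 0 -> i \in t].
Proof.
have s1 := @to_sphere_in R m u.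
have [s sK [p0 ps _]] := h_in s1; have [t tK [q0 qt _]] := h_in (sphereN s1).
exists s, t; split=> // i; rewrite !mxE; apply: contraTT => ni.
  by rewrite ps // sub0r -leNgt oppr_le0 q0.
by rewrite qt // subr0 -leNgt p0.
Qed.

(** The norm of [gap] has a positive minimum on the cube, and the coordinates of [gap] sum to 0, so
    both signs occur with a uniform margin. *)
Lemma gap_gt : exists2 e, 0 < e & forall u, `|u| <= 1 ->
  (exists i, e <= gap u ord0 i) /\ (exists i, e <= (- gap u) ord0 i).
Proof.
have [e e0 eP] := cube_norm_ge continuous_gap (fun u _ => gap_neq0 u).
exists (e / N.+1%:R) => [|u /eP eu]; first by rewrite divr_gt0.
split; apply: large_coord_sum0; rewrite ?normrN ?eu ?sum_gap //.
have -> : \sum_i (- gap u) ord0 i = - \sum_i gap u ord0 i.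
  by rewrite -sumrN; apply: eq_bigr => i _; rewrite [LHS]mxE.
by rewrite sum_gap oppr0.
Qed.

Lemma obstruction : False.
Proof.
have [e e0 eP] := gap_gt.
have [M MP] := cube_unif_continuous continuous_gap e0.
have [i0 _] : exists i, e <= gap 0 ord0 i by apply: (eP 0 _).1; rewrite normr0.
pose V := {ffun 'I_m -> 'I_(M.+1.*2).+1}.
pose big (z : 'rV[R]_N) := odflt i0 [pick i | e <= z ord0 i].
pose I (v : V) := big (gap (vtx R v)).
pose J (v : V) := big (- gap (vtx R v)).
have gapI v : e <= gap (vtx R v) ord0 (I v).
  rewrite /I /big; case: pickP => //= none.
  by have [[i]] := eP _ (vtx_norm R v); rewrite none.
have gapJ v : e <= (- gap (vtx R v)) ord0 (J v).
  rewrite /J /big; case: pickP => //= none.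
  by have [_ [i]] := eP _ (vtx_norm R v); have /= -> := none i.
have near v w (u : 'rV[R]_m) i : v \in active M u -> w \in active M u ->
    `|gap (vtx R v) ord0 i - gap (vtx R w) ord0 i| < e.
  rewrite !inE => va wa; have := MP _ _ (vtx_norm R v) (hat_vtx_near va wa).
  by apply: le_lt_trans; have := ler_coord_norm (gap (vtx R v) - gap (vtx R w)) i; rewrite !mxE.
(* A coordinate at least [e] at [v] is still positive at every [w] active with it. So all labels [I]
   in play lie in the positive support of [gap] at any one active vertex, and likewise all [J] in
   the negative support. *)
have nearI v w (u : 'rV[R]_m) : v \in active M u -> w \in active M u ->
    0 < gap (vtx R w) ord0 (I v).
  by move=> va wa; have := near _ _ _ (I v) va wa; have := gapI v; rewrite ltr_norml; lra.
have nearJ v w (u : 'rV[R]_m) : v \in active M u -> w \in active M u ->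
    gap (vtx R w) ord0 (J v) < 0.
  by move=> va wa; have := near _ _ _ (J v) va wa; have := gapJ v; rewrite mxE ltr_norml; lra.
have IJ (u : 'rV[R]_m) : {in active M u &, forall v w, I v != J w}.
  move=> v w va wa; apply/eqP => e'; have := nearI v w u va wa; rewrite e'.
  by have := nearJ w w u wa wa; lra.
(* Dividing by generic weights turns equal coordinates into label masses proportional to the
   weights, the situation excluded by [no_tie]. *)
pose z (L : V -> 'I_N) (u : 'rV[R]_m) : 'rV[R]_N :=
  \row_i (\sum_v hat v u * (L v == i)%:R / (weight i)%:R).
have term_ge0 (L : V -> 'I_N) v (u : 'rV[R]_m) i : 0 <= hat v u * (L v == i)%:R / (weight i)%:R.
  by apply: divr_ge0 => //; apply: mulr_ge0; [exact: hat_ge0|exact: ler0n].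
have z_ge0 L u i : 0 <= z L u ord0 i.
  by rewrite mxE; apply: sumr_ge0 => v _; exact: term_ge0.
have supp_z L u i : 0 < z L u ord0 i -> exists2 v, v \in active M u & L v = i.
  rewrite mxE => zi; apply: contrapT => none; move: zi; rewrite big1 ?ltxx // => v _.
  have [Lv|] := eqVneq (L v) i; last by rewrite mulr0 mul0r.
  have [va|va] := boolP (v \in active M u); first by case: none; exists v.
  by rewrite hat_eq0 ?mul0r //; move: va; rewrite inE.
have cont_z L : continuous (z L).
  apply: continuous_row => i; apply: continuous_bigsum => v.
  apply: continuous_mul2; last exact: cst_continuous.
  by apply: continuous_mul2; [exact: continuous_hat|exact: cst_continuous].
pose p u := truncation d (z I u).
pose q u := truncation d (z J u).
(* At a boundary point only boundary vertices have nonzero hats, and there the antipode exchanges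
   [I] and [J]. *)
have zN L L' u : `|u| = 1 -> (forall v, `|vtx R v| = 1 -> L (opp_vtx v) = L' v) ->
    z L (- u) = z L' u.
  move=> u1 LL'; apply/rowP => i; rewrite !mxE (reindex_inj (inv_inj (@opp_vtxK _ _))).
  apply: eq_bigr => v _; rewrite hatN; have [va|va] := boolP (0 < hat v u).
    by rewrite LL' // (hat_boundary va).
  by rewrite hat_eq0 ?mul0r.
have IN v : `|vtx R v| = 1 -> I (opp_vtx v) = J v by move=> v1; rewrite /I vtxN gapN.
have JN v : `|vtx R v| = 1 -> J (opp_vtx v) = I v by move=> v1; rewrite /J vtxN gapN ?opprK.
have skelP L u (s : {set 'I_N}) : s \in K -> (forall v, v \in active M u -> L v \in s) ->
    truncation d (z L u) != 0 -> skel (normalize (truncation d (z L u))).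
  move=> sK Ls t0; set t := truncation d _ in t0 *.
  have t_ge0 i : 0 <= t ord0 i by exact: truncation_ge0.
  have mt0 : 0 < mass t by rewrite lt_neqAle eq_sym mass_eq0 // t0 sumr_ge0.
  exists (supp t); last split.
  - rewrite inE; apply/andP; split; last exact: card_supp_truncation.
    apply: (Kcomplex.2 s) => //.
      apply/fintype.subsetP => i /(fintype.subsetP (supp_truncation d _)).
      by rewrite inE => /supp_z[v va <-]; exact: Ls.
    apply: contraNneq t0 => t0; apply/eqP/rowP => i; rewrite [RHS]mxE.
    apply/le_anti; rewrite t_ge0 andbT leNgt; apply/negP => ti.
    by have := finset.in_set0 i; rewrite -t0 inE ti.
  - by move=> i; rewrite mxE mulr_ge0 // invr_ge0 ltW.
  - move=> i; rewrite inE -leNgt => ti; have t0i : t ord0 i = 0 by apply/le_anti; rewrite ti t_ge0.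
    by rewrite mxE t0i mulr0.
  - under eq_bigr do rewrite mxE.
    by rewrite -mulr_sumr mulVf // gt_eqF.
have trunc0 L u : truncation d (z L u) != 0 -> exists v, v \in active M u.
  move=> t0; apply: contrapT => none; case/eqP: t0; apply/rowP => i; rewrite mxE [RHS]mxE.
  apply/max_idPl; rewrite subr_le0; apply: le_trans (threshold_ge0 _ _).
  by rewrite leNgt; apply/negP => /supp_z[v va _]; apply: none; exists v.
have skel_p u : p u != 0 -> skel (normalize (p u)).
  move=> p0; have [v va] := trunc0 _ _ p0; have [s [t [sK tK sP tP]]] := gap_carrier (vtx R v).
  by apply: skelP sK _ p0 => w wa; apply: sP; exact: nearI wa va.
have skel_q u : q u != 0 -> skel (normalize (q u)).
  move=> q0; have [v va] := trunc0 _ _ q0; have [s [t [sK tK sP tP]]] := gap_carrier (vtx R v).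
  by apply: skelP tK _ q0 => w wa; apply: tP; exact: nearJ wa va.
have f1 x : skel x -> `|f x| <= 1.
  move=> /f_in fx; apply/norm_rV_leP => // i.
  rewrite -(@ler_pXn2r _ 2) ?nnegrE // expr1n real_normK ?num_real //.
  by rewrite -[leRHS]fx (bigD1 i) //= lerDl sumr_ge0 // => j _; exact: sqr_ge0.
(* Source and target both have dimension [2 * d + 1], since [f] takes values in the unit sphere of
   that space. *)
have [u u1] : exists2 u, `|u| <= 1 & cone f (p u) - cone f (q u) = 0.
  apply: borsuk_ulam_cube => [|u u1].
    apply: continuous_sub2; apply: continuous_cone f_cont f1 => //.
    - exact: continuous_truncation.
    - by move=> u i; exact: truncation_ge0.
    - exact: continuous_truncation.
    - by move=> u i; exact: truncation_ge0.
  by rewrite /p /q (zN I J) // (zN J I) // opprB.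
move=> /eqP; rewrite subr_eq0 => /eqP pq.
have p_ge0 i : 0 <= p u ord0 i by exact: truncation_ge0.
have q_ge0 i : 0 <= q u ord0 i by exact: truncation_ge0.
have mp0 : 0 <= mass (p u) by exact: sumr_ge0.
have mq0 : 0 <= mass (q u) by exact: sumr_ge0.
(* As [f] has unit values, the Euclidean norm of [cone f x] is the mass of [x]; equal cones thus
   have equal masses. *)
have sq_cone (x : 'rV[R]_N) : (forall i, 0 <= x ord0 i) -> (x != 0 -> skel (normalize x)) ->
    sqnorm (cone f x) = mass x ^+ 2.
  move=> x0 xs; rewrite sqnormZ; have [->|xn0] := eqVneq x 0.
    by rewrite /mass big1 ?expr0n ?mul0r // => i _; rewrite mxE.
  by rewrite [sqnorm _](f_in (xs xn0)) mulr1.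
have mpq : mass (p u) = mass (q u).
  apply/eqP; rewrite -(@eqrXn2 _ 2) //; apply/eqP.
  by rewrite -!sq_cone ?pq //; [exact: skel_q|exact: skel_p].
have [p0|pn0] := eqVneq (p u) 0.
  have q0 : q u = 0 by apply/eqP; rewrite -mass_eq0 // -mpq mass_eq0 // p0.
  have [v va] := hat_exists M u1.
  have zn0 L : z L u != 0.
    apply/eqP => /rowP/(_ (L v)); rewrite [LHS]mxE [RHS]mxE => /eqP; rewrite gt_eqF //.
    rewrite (bigD1 v) //=; apply: ltr_pwDl; last by apply: sumr_ge0 => w _; exact: term_ge0.
    by rewrite eqxx mulr1 divr_gt0 // ltr0n.
  have [A [a [cA a0 Aa]]] := truncation_eq0 (z_ge0 I u) (zn0 I) p0.
  have [B [b [cB b0 Bb]]] := truncation_eq0 (z_ge0 J u) (zn0 J) q0.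
  have sumE L i a' : z L u ord0 i = a' ->
      \sum_(v in active M u | L v == i) hat v u = a' * (weight i)%:R.
    move=> <-; rewrite mxE mulr_suml big_mkcond /=; apply: eq_bigr => w _.
    rewrite mulfVK ?pnatr_eq0 // inE; have [wa|wa] := boolP (0 < hat w u).
      by case: eqP => _; rewrite ?mulr1 ?mulr0.
    by rewrite hat_eq0 ?mul0r.
  apply: (@no_tie N R V (active M u) (fun v => hat v u) I J A B a b) => //.
  (* The count is met exactly: at most [2 * d + 2] active vertices, plus 2, against twice [d + 2]
     tied positions. *)
  - rewrite cA cB (leq_trans (_ : _ <= (2 * d).+2 + 2)%N) ?leq_add2r ?card_active //; lia.
  - by move=> w; rewrite inE.
  - by move=> i /Aa; exact: sumE.
  - by move=> i /Bb; exact: sumE.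
have qn0 : q u != 0 by rewrite -mass_eq0 // -mpq mass_eq0.
have m0 : mass (p u) != 0 by rewrite mass_eq0.
have npq : normalize (p u) = normalize (q u).
  apply: f_inj; [exact: skel_p|exact: skel_q|].
  by move: pq; rewrite /cone -mpq => /(scalerI m0).
have {}npq : p u = q u.
  by move: npq; rewrite /normalize -mpq; apply: scalerI; rewrite invr_eq0.
(* A position in the common support is a label [I v] and a label [J w] of active vertices, against
   [IJ]. *)
have [i ip] : exists i, i \in supp (p u).
  apply/set0Pn; apply: contraNneq pn0 => p0; apply/eqP/rowP => i; rewrite [RHS]mxE.
  apply/le_anti; rewrite p_ge0 andbT leNgt; apply/negP => ti.
  by have := finset.in_set0 i; rewrite -p0 inE ti.
have iq : i \in supp (q u) by rewrite -npq.
have /(fintype.subsetP (supp_truncation d _)) := ip; rewrite inE => /supp_z[v va vi].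
have /(fintype.subsetP (supp_truncation d _)) := iq; rewrite inE => /supp_z[w wa wi].
by have := IJ u v w va wa; rewrite vi wi eqxx.
Qed.

End Obstruction.

Theorem theorem5 (R : realType) (d N : nat) (K : {set {set 'I_N}}) :
  is_simplicial_complex K ->
  are_homeomorphic (geom_realization R K) (unit_sphere R (2 * d + 1)) ->
  ~ top_embeds (geom_realization R (sc_skeleton K d)) (unit_sphere R (2 * d)).
Proof.
rewrite addn1 => Kc [r [h [[_ hK _ fh] [_ ch]]]] [f [fS [g [gf cf _]]]].
apply: (obstruction Kc (h := h) (f := f)) => //.
- by move=> x Sx; rewrite -hK; exists x.
- by move=> x y Sx Sy e; rewrite -(fh x Sx) e fh.
- by move=> x Kx; apply: fS; exists x.
- by move=> x y Kx Ky e; rewrite -(gf x Kx) e gf.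
Qed.
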